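(* Let $M$ be a compact Riemannian manifold and let $X$ be a flow (i.e. a $C^1$ vector field) on $M$. If $\Lambda_+\subset M$ is a transitive positively sectional-hyperbolic set of $X$ and $\Lambda_-\subset M$ is a transitive negatively sectional-hyperbolic set of $X$, then $\Lambda_+\cap\Lambda_-$ is a hyperbolic set of $X$.
   Context: $M$ has Riemannian metric $\langle\cdot,\cdot\rangle$ and induced norm $\|\cdot\|$. A flow is a $C^1$ vector field $X$ on $M$, with induced flow $X_t$; $-X$ is the reversed flow. $\mathrm{Sing}(X)$ is the set of zeroes (singularities) of $X$. A set $\Lambda$ is invariant if $X_t(\Lambda)=\Lambda$ for all $t\in\mathbb{R}$. $\omega(x)$ is the set of $y\in M$ with $y=\lim_n X_{t_n}(x)$ for some $t_n\to\infty$. A set $\Lambda$ is transitive if there is $x\in\Lambda$ with $\omega(x)=\Lambda$. Hyperbolic: a compact invariant set $\Lambda$ (possibly empty) is hyperbolic if there are a continuous $DX_t$-invariant splitting $T_\Lambda M=E^s\oplus E^X\oplus E^u$ and $K,\lambda>0$ such that (1) $E^s$ is contracting: $\|DX_t(x)v\|\le Ke^{-\lambda t}\|v\|$ for all $x\in\Lambda$, $v\in E^s_x$, $t\ge0$; (2) $E^X_x$ is the subspace of $T_xM$ generated by $X(x)$; (3) $E^u$ is expanding: $\|DX_t(x)v\|\ge K^{-1}e^{\lambda t}\|v\|$ for all $x\in\Lambda$, $v\in E^u_x$, $t\ge0$. Subbundles may be zero. A singularity $\sigma$ is hyperbolic if $\{\sigma\}$ is a hyperbolic set. Dominated splitting: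 a compact invariant set $\Lambda$ has a dominated splitting with respect to the tangent flow if there are a $DX_t$-invariant splitting into subbundles $T_\Lambda M=E\oplus F$ and $K,\lambda>0$ with $\|DX_t(x)e\|\cdot\|f\|\le Ke^{-\lambda t}\|DX_t(x)f\|\cdot\|e\|$ for all $x\in\Lambda$, $t\ge0$, $(e,f)\in E_x\times F_x$ (either subbundle may be zero). It is a partially hyperbolic splitting if moreover $E$ is contracting. For $u,v\in T_pM$ let $\|u,v\|=\sqrt{\langle u,u\rangle\langle v,v\rangle-\langle u,v\rangle^2}$ (area of the parallelogram spanned by $u,v$). $F$ is sectionally expanding if there are $K,\lambda>0$ with $\|DX_t(x)u,DX_t(x)v\|\ge K^{-1}e^{\lambda t}\|u,v\|$ for all $x\in\Lambda$, $u,v\in F_x$, $t\ge0$. A sectional-hyperbolic splitting for $X$ over $\Lambda$ is a partially hyperbolic splitting $T_\Lambda M=E\oplus F$ with $F$ sectionally expanding. A compact invariant set $\Lambda$ is sectional-hyperbolic for $X$ if every singularity of $X$ in $\Lambda$ is hyperbolic and there is a sectional-hyperbolic splitting for $X$ over $\Lambda$. It is positively (resp. negatively) sectional-hyperbolic if it is sectional-hyperbolic for $X$ (resp. for $-X$). *)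

(* Defs.v *)
From HB Require Import structures.
From mathcomp Require Import all_boot all_order all_algebra.
From mathcomp Require Import all_classical all_reals all_analysis.

Set Implicit Arguments.
Unset Strict Implicit.
Unset Printing Implicit Defensive.

Import Order.TTheory GRing.Theory Num.Theory numFieldNormedType.Exports.

Local Open Scope classical_set_scope.
Local Open Scope ring_scope.

(** * Calculus on open subsets of a normed space *)

Fixpoint Ck (R : realType) (V W : normedModType R) (k : nat) (U : set V)
    (f : V -> W) : Prop :=
  if k is k'.+1 then
    (forall x, U x -> differentiable f x) /\
    (forall v : V, Ck k' U (fun x => 'D_v f x))
  else forall x, U x -> {for x, continuous f}.

Definition smooth_on (R : realType) (V W : normedModType R) (U : set V)
  (f : V -> W) : Prop := forall k, Ck k U f.

(** * Smooth manifolds without boundary *)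

(** Charts and their inverses are total functions; their values outside
    [dom i], resp. outside the image of [dom i], are irrelevant.  As each point
    [x] carries a preferred chart [chart_at x], the tangent space at [x] can be
    represented by the model space, a vector being given by its coordinates in
    the preferred chart. *)
Record manifold (R : realType) (n : nat) := Manifold {
  carrier :> topologicalType;
  manifold_hausdorff : hausdorff_space carrier;
  manifold_second_countable : @second_countable carrier;
  chart_index : Type;
  dom : chart_index -> set carrier;
  chart : chart_index -> carrier -> 'rV[R]_n;
  chartV : chart_index -> 'rV[R]_n -> carrier;
  chart_at : carrier -> chart_index;
  dom_chart_at : forall x, dom (chart_at x) x;
  open_dom : forall i, open (dom i);
  open_image : forall i, open (chart i @` dom i);
  chartK : forall i x, dom i x -> chartV i (chart i x) = x;
  chart_continuous : forall i x, dom i x -> {for x, continuous (chart i)};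
  chartV_continuous : forall i y, (chart i @` dom i) y ->
    {for y, continuous (chartV i)};
  transition_smooth : forall i j,
    smooth_on (chart i @` (dom i `&` dom j)) (chart j \o chartV i)
}.

Definition tangent (R : realType) (n : nat) (M : manifold R n) (x : M) :=
  'rV[R]_n.

(** [tcoord i x] maps a tangent vector at [x] to its coordinates in the chart
    [i], and [tvec i x] is the inverse map (both for [x] in [dom i]). *)
Definition tcoord (R : realType) (n : nat) (M : manifold R n)
    (i : chart_index M) (x : M) : tangent x -> 'rV[R]_n :=
  'd (chart i \o chartV (chart_at x)) (chart (chart_at x) x).

Definition tvec (R : realType) (n : nat) (M : manifold R n)
    (i : chart_index M) (x : M) : 'rV[R]_n -> tangent x :=
  'd (chart (chart_at x) \o chartV i) (chart i x).

Arguments tcoord {R n M} i x _.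
Arguments tvec {R n M} i x _.

Definition tmap (R : realType) (n : nat) (M : manifold R n)
    (f : M -> M) (x : M) : 'Hom('rV[R]_n, 'rV[R]_n) :=
  linfun ('d (chart (chart_at (f x)) \o f \o chartV (chart_at x))
             (chart (chart_at x) x)).

(** * Riemannian metrics *)

Record metric (R : realType) (n : nat) (M : manifold R n) := Metric {
  inner :> forall x : M, tangent x -> tangent x -> R;
  inner_sym : forall x u v, @inner x u v = @inner x v u;
  inner_linear : forall x (a : R) (u v w : 'rV[R]_n),
    @inner x (a *: u + v) w = a * @inner x u w + @inner x v w;
  inner_pos : forall x (u : 'rV[R]_n), u != 0 -> 0 < @inner x u u;
  inner_smooth : forall (i : chart_index M) (u v : 'rV[R]_n),
    smooth_on (chart i @` dom i)
      (fun y => @inner (chartV i y) (tvec i _ u) (tvec i _ v))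
}.

Definition tnorm (R : realType) (n : nat) (M : manifold R n) (g : metric M)
  (x : M) (v : tangent x) : R := Num.sqrt (g x v v).

Definition area (R : realType) (n : nat) (M : manifold R n) (g : metric M)
    (x : M) (u v : tangent x) : R :=
  Num.sqrt (g x u u * g x v v - g x u v ^+ 2).

Arguments tnorm {R n M} g x v.
Arguments area {R n M} g x u v.

(** * Flows *)

Definition C1_field (R : realType) (n : nat) (M : manifold R n)
    (X : forall x : M, tangent x) : Prop :=
  forall i : chart_index M, Ck 1 (chart i @` dom i)
    (fun y => tcoord i _ (X (chartV i y))).

(** The derivative of [t |-> chart i (Xt t x)] alone does not control the curve,
    because [chart i] is arbitrary outside its domain: continuity of the
    trajectories has to be required separately. *)
Definition flow_of (R : realType) (n : nat) (M : manifold R n)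
    (X : forall x : M, tangent x) (Xt : R -> M -> M) : Prop :=
  [/\ forall x, Xt 0 x = x,
      forall x, continuous (fun t => Xt t x) &
      forall x (t : R) (i : chart_index M), dom i (Xt t x) ->
        is_derive t (1 : R) (fun s => chart i (Xt s x))
          (tcoord i _ (X (Xt t x)))].

(** A [C^1] vector field together with its induced flow, which on a compact
    manifold exists and is uniquely determined by the field. *)
Record flow (R : realType) (n : nat) (M : manifold R n) := Flow {
  field : forall x : M, tangent x;
  field_C1 : C1_field field;
  trajectory :> R -> M -> M;
  trajectoryP : flow_of field trajectory
}.

Lemma C1_fieldN (R : realType) (n : nat) (M : manifold R n)
    (X : forall x : M, tangent x) :
  C1_field X -> C1_field (fun x => - X x : 'rV[R]_n).
Proof.
move=> X1 i; have [dX cX] := X1 i; set U := chart i @` dom i in dX cX *.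
pose f y := tcoord i _ (X (chartV i y)).
rewrite [X in Ck _ _ X](_ : _ = - f); last first.
  by apply/funext => y; rewrite /tcoord linearN.
split=> [x Ux|v x Ux]; first exact/differentiableN/dX.
have DN y : U y -> 'D_v (- f) y = - 'D_v f y.
  by move=> Uy; rewrite deriveN//; exact/diff_derivable/dX.
rewrite /= /prop_for /continuous_at DN//.
have Ux' : nbhs x U by apply: open_nbhs_nbhs; split=> //; exact: open_image.
have E : {near x, (- 'D_v f) =1 'D_v (- f)}.
  exact: (filterS (fun y Uy => esym (DN y Uy)) Ux').
exact: cvg_trans (near_eq_cvg E) (continuousN (cX v x Ux)).
Qed.

Lemma flow_ofN (R : realType) (n : nat) (M : manifold R n)
    (X : forall x : M, tangent x) (Xt : R -> M -> M) :
  flow_of X Xt ->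
  flow_of (fun x => - X x : 'rV[R]_n) (fun t => Xt (- t)).
Proof.
case=> Xt0 cXt dXt; split=> [x|x t|x t i dt]; first by rewrite oppr0.
- by apply: (@continuous_comp _ _ _ -%R (Xt^~ x)); [exact: oppr_continuous|exact: cXt].
- pose c s := chart i (Xt s x).
  have [dc Dc] : is_derive (- t) (1 : R) c (tcoord i _ (X (Xt (- t) x))).
    exact: dXt.
  have dN : differentiable (-%R : R -> R) t by [].
  have {}dc : differentiable c (- t) by exact/derivable1_diffP.
  have dcN : differentiable (c \o -%R) t by exact: differentiable_comp.
  apply: (@DeriveDef _ _ _ _ _ (c \o -%R)); first exact: diff_derivable.
  rewrite deriveE// diff_comp//= -(deriveE _ dN).
  have -> : 'D_1 (-%R : R -> R) t = - 1 by rewrite derive_val.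
  by rewrite linearN/= -deriveE// Dc /tcoord linearN.
Qed.

Definition reverse (R : realType) (n : nat) (M : manifold R n) (X : flow M) :
    flow M :=
  Flow (C1_fieldN (@field_C1 _ _ _ X)) (flow_ofN (trajectoryP X)).

Definition Sing (R : realType) (n : nat) (M : manifold R n) (X : flow M) :
  set M := [set x | field X x = 0 :> 'rV[R]_n].

Definition invariant_set (R : realType) (n : nat) (M : manifold R n) (X : flow M)
  (L : set M) : Prop := forall t, X t @` L = L.

Definition omega (R : realType) (n : nat) (M : manifold R n) (X : flow M)
    (x : M) : set M :=
  [set y | exists2 t : nat -> R,
    t @ \oo --> +oo & (fun k => X (t k) x) @ \oo --> y].

Definition transitive_set (R : realType) (n : nat) (M : manifold R n)
  (X : flow M) (L : set M) : Prop := exists2 x, L x & omega X x = L.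

(** * Splittings of the tangent bundle over a set *)

(** A family of subspaces of the tangent spaces. Only its values over the set
    under consideration matter. *)
Definition subspaces (R : realType) (n : nat) (M : manifold R n) :=
  M -> {vspace 'rV[R]_n}.

(** A continuous vector subbundle of the tangent bundle restricted to
    [L]: near every point of [L] it has a continuous frame. The rank is thus
    locally constant on [L], but may differ from one component to another. *)
Definition subbundle (R : realType) (n : nat) (M : manifold R n) (L : set M)
    (E : subspaces M) : Prop :=
  forall x, L x -> exists (U : set M) (d : nat) (b : 'I_d -> M -> 'rV[R]_n),
    [/\ open U, U x, U `<=` dom (chart_at x),
        forall k, {within L `&` U,
          continuous (fun y => tcoord (chart_at x) y (b k y))} &
        forall y, (L `&` U) y -> basis_of (E y) [tuple b k y | k < d]].

Definition invariant_bundle (R : realType) (n : nat) (M : manifold R n)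
    (X : flow M) (L : set M) (E : subspaces M) : Prop :=
  forall t x, L x -> (tmap (X t) x @: E x)%VS = E (X t x).

Definition contracting (R : realType) (n : nat) (M : manifold R n)
    (g : metric M) (X : flow M) (L : set M) (E : subspaces M) (K lam : R) :=
  forall x v t, L x -> v \in E x -> 0 <= t ->
    tnorm g (X t x) (tmap (X t) x v)
      <= K * expR (- lam * t) * tnorm g x v.

Definition expanding (R : realType) (n : nat) (M : manifold R n)
    (g : metric M) (X : flow M) (L : set M) (E : subspaces M) (K lam : R) :=
  forall x v t, L x -> v \in E x -> 0 <= t ->
    K^-1 * expR (lam * t) * tnorm g x v
      <= tnorm g (X t x) (tmap (X t) x v).

Definition sectionally_expanding (R : realType) (n : nat) (M : manifold R n)
    (g : metric M) (X : flow M) (L : set M) (F : subspaces M) (K lam : R) :=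
  forall x u v t, L x -> u \in F x -> v \in F x -> 0 <= t ->
    K^-1 * expR (lam * t) * area g x u v
      <= area g (X t x) (tmap (X t) x u) (tmap (X t) x v).

Definition flow_direction (R : realType) (n : nat) (M : manifold R n)
  (X : flow M) : subspaces M := fun x => <[field X x : 'rV[R]_n]>%VS.

Definition hyperbolic_splitting (R : realType) (n : nat) (M : manifold R n)
    (g : metric M) (X : flow M) (L : set M) (Es Eu : subspaces M) : Prop :=
  let EX := flow_direction X in
  [/\ [/\ subbundle L Es, subbundle L EX & subbundle L Eu],
      [/\ invariant_bundle X L Es, invariant_bundle X L EX
        & invariant_bundle X L Eu],
      forall x, L x ->
        (Es x + EX x + Eu x)%VS = fullv /\ directv (Es x + EX x + Eu x) &
      exists K lam : R, [/\ 0 < K, 0 < lam, contracting g X L Es K lam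
                          & expanding g X L Eu K lam]].

Definition hyperbolic (R : realType) (n : nat) (M : manifold R n)
    (g : metric M) (X : flow M) (L : set M) : Prop :=
  [/\ compact L, invariant_set X L
    & exists Es Eu, hyperbolic_splitting g X L Es Eu].

Definition dominated_splitting (R : realType) (n : nat) (M : manifold R n)
    (g : metric M) (X : flow M) (L : set M) (E F : subspaces M) : Prop :=
  [/\ subbundle L E /\ subbundle L F,
      invariant_bundle X L E /\ invariant_bundle X L F,
      forall x, L x -> (E x + F x)%VS = fullv /\ directv (E x + F x) &
      exists K lam : R, [/\ 0 < K, 0 < lam &
        forall x t e f, L x -> 0 <= t -> e \in E x -> f \in F x ->
          tnorm g (X t x) (tmap (X t) x e) * tnorm g x f
            <= K * expR (- lam * t)
               * tnorm g (X t x) (tmap (X t) x f) * tnorm g x e]].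

Definition partially_hyperbolic_splitting (R : realType) (n : nat)
    (M : manifold R n) (g : metric M) (X : flow M) (L : set M)
    (E F : subspaces M) : Prop :=
  dominated_splitting g X L E F /\
  exists K lam : R, [/\ 0 < K, 0 < lam & contracting g X L E K lam].

Definition sectional_hyperbolic_splitting (R : realType) (n : nat)
    (M : manifold R n) (g : metric M) (X : flow M) (L : set M)
    (E F : subspaces M) : Prop :=
  partially_hyperbolic_splitting g X L E F /\
  exists K lam : R, [/\ 0 < K, 0 < lam & sectionally_expanding g X L F K lam].

Definition sectional_hyperbolic (R : realType) (n : nat) (M : manifold R n)
    (g : metric M) (X : flow M) (L : set M) : Prop :=
  [/\ compact L, invariant_set X L,
      forall s, (L `&` Sing X) s -> hyperbolic g X [set s]
    & exists E F, sectional_hyperbolic_splitting g X L E F].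

Definition positively_sectional_hyperbolic (R : realType) (n : nat)
    (M : manifold R n) (g : metric M) (X : flow M) (L : set M) : Prop :=
  sectional_hyperbolic g X L.

Definition negatively_sectional_hyperbolic (R : realType) (n : nat)
    (M : manifold R n) (g : metric M) (X : flow M) (L : set M) : Prop :=
  sectional_hyperbolic g (reverse X) L.

(* Main.v *)
Require Import Defs.
From mathcomp Require Import all_boot all_order all_algebra.
From mathcomp Require Import all_classical all_reals all_analysis.
From mathcomp Require Import ring lra zify.

(** Write [Lp] and [Lm] for the two sets, with splittings [E + F] over [Lp] for the
    flow and [E' + F'] over [Lm] for the reversed flow. On the intersection, [E] is
    contracting and [E'] is expanding, and the claim is that together with the
    flow direction they fill the tangent space.

    Independence. A vector with a bounded past has no component in [E], for such
    a component would grow exponentially in the past and, by domination, outgrow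
    the component in [F] ([dominated_bounded_past]). As the field is bounded on a
    compact manifold, it lies in [F] over [Lp], and in [F'] over [Lm]
    ([field_in_center]). For similar reasons [E], the flow direction and [E'] are
    independent ([hyperbolic_independent]).

    Dimension. The area of a parallelogram in [F] grows in the future, and that of
    one in [F'] grows in the past, so [F] and [F'] meet in dimension at most one
    ([center_cap_dim]); hence the dimensions of [E] and [E'] add up to at least
    [n - 1] ([strong_dims]). Where the field does not vanish, its direction
    supplies the missing dimension ([regular_hyperbolic_splitting]).

    Singularities. Suppose that the intersection contains a singularity [sigma].
    If one of the sets is reduced to it, the intersection is [sigma] alone, which
    is hyperbolic by assumption. Otherwise transitivity provides orbits of [Lp]
    that approach [sigma] from a distance. If the stable space of [sigma] were
    [E sigma], then [F sigma] would be the unstable space; the velocities along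
    these orbits lie in [F], so they would not decrease during the approach,
    although the field vanishes at [sigma]. Hence the stable space is larger than
    [E sigma] ([singular_gap]). Likewise the unstable space is larger than
    [E' sigma], and the dimensions add up to more than [n]
    ([no_common_singularity]).

    All this uses that the flow is a group of continuous maps whose tangent maps
    form a cocycle. Uniqueness and continuous dependence of integral curves are
    proved in charts by Gronwall's inequality ([integral_curves_near],
    [uniform_time]). Differentiability of the flow comes for free where it is
    needed, because the invariant splittings force the tangent maps to be onto
    ([onto_differentiable]). *)

Set Implicit Arguments.
Unset Strict Implicit.
Unset Printing Implicit Defensive.

Import Order.TTheory GRing.Theory Num.Theory numFieldNormedType.Exports.

Local Open Scope classical_set_scope.
Local Open Scope ring_scope.

(** * Differential inequalities *)

Section calculus.
Variables (R : realType) (n : nat).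
Implicit Types (u v : 'rV[R]_n).

Lemma coord_le_norm v j : `|v 0 j| <= `|v|.
Proof.
rewrite [leRHS]/Num.Def.normr/= mx_normrE.
exact: (le_bigmax_cond _ (fun ij : 'I_1 * 'I_n => `|v ij.1 ij.2|) (j := (0, j))).
Qed.

Lemma norm_le_coord v c : 0 <= c -> (forall j, `|v 0 j| <= c) -> `|v| <= c.
Proof.
move=> c0 vc; rewrite [leLHS]/Num.Def.normr/= mx_normrE.
by apply: bigmax_le => // -[i j] _ /=; rewrite ord1.
Qed.

Lemma linear_bounded (W : normedModType R) (f : {linear 'rV[R]_n -> W}) :
  exists2 C, 0 < C & forall v, `|f v| <= C * `|v|.
Proof.
exists (1 + \sum_j `|f 'e_j|).
  by rewrite ltr_pwDl// sumr_ge0.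
move=> v; rewrite {1}[v]row_sum_delta linear_sum (le_trans (ler_norm_sum _ _ _))//.
rewrite mulrDl mul1r ler_wpDl// mulr_suml ler_sum// => j _.
by rewrite linearZ/= normrZ mulrC ler_wpM2l// coord_le_norm.
Qed.

Lemma linear_rV_continuous (W : normedModType R) (f : {linear 'rV[R]_n -> W}) :
  continuous f.
Proof.
have [C C0 fC] := linear_bounded f; apply/linear_bounded_continuous.
exists C; split; first exact: gtr0_real.
move=> x Cx; apply: (filterS _ (@nbhs0_le _ _ 1 ltr01)) => v /= v1.
by apply: le_trans (fC v) _; apply: le_trans (ltW Cx); rewrite ler_piMr// ltW.
Qed.

Lemma le_of_eq (a b : R) : a = b -> a <= b.
Proof. by move->. Qed.

Lemma expR_small (C lam a : R) : 0 < lam -> 0 < a ->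
  exists2 T, 0 <= T & forall t, T <= t -> C * expR (- lam * t) <= a.
Proof.
move=> lam0 a0; exists (`|C| / (a * lam)).
  by rewrite divr_ge0// mulr_ge0// ltW.
move=> t Tt; rewrite mulNr expRN ler_pdivrMr ?expR_gt0//.
apply: le_trans (ler_norm C) _.
have le1 : `|C| <= a * (lam * t) by rewrite mulrA -ler_pdivrMl ?mulr_gt0// mulrC.
apply: le_trans le1 _; rewrite ler_wpM2l ?(ltW a0)//.
by apply: le_trans (expR_ge1Dx _); rewrite lerDr.
Qed.

Lemma injective_lower_bound (f : 'End('rV[R]_n)) :
  (forall h, f h = 0 -> h = 0) -> exists2 m, 0 < m & forall h, m * `|h| <= `|f h|.
Proof.
move=> inj; have k0 : lker f == 0%VS.
  by rewrite -subv0; apply/subvP => h; rewrite memv_ker memv0 => /eqP/inj ->.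
have [C C0 leC] := linear_bounded (f^-1%VF : {linear 'rV[R]_n -> 'rV[R]_n}).
exists C^-1; first by rewrite invr_gt0.
by move=> h; rewrite ler_pdivrMl// -{1}(lker0_lfunK k0 h); exact: leC.
Qed.

(** The mean value theorem is applied to each coordinate; nothing is lost because
    the norm is the sup norm. *)
Lemma mean_value_ineq (u du : R -> 'rV[R]_n) (phi dphi : R -> R) (t : R) :
  0 <= t ->
  (forall s, 0 <= s <= t -> is_derive s (1 : R) u (du s)) ->
  (forall s, 0 <= s <= t -> is_derive s (1 : R) phi (dphi s)) ->
  (forall s, 0 < s < t -> `|du s| <= dphi s) ->
  `|u t - u 0| <= phi t - phi 0.
Proof.
rewrite le_eqVlt => /predU1P[<- _ _ _|t0 Du Dphi le_du].
  by rewrite !subrr normr0.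
have itvW s : s \in `]0, t[ -> 0 <= s <= t.
  by rewrite in_itv/= => /andP[s0 st]; rewrite !ltW.
have phi_incr (sg : R) j : `|sg| = 1 ->
    sg * (u t 0 j - u 0 0 j) <= phi t - phi 0.
  move=> sg1; pose h s := phi s - sg * u s 0 j.
  have Dh s : 0 <= s <= t -> is_derive s (1 : R) h (dphi s - sg * du s 0 j).
    move=> st; have [du1 du2] := Du s st; have := Dphi s st => Dphis.
    have [dj Ej] : is_derive s (1 : R) (fun s => u s 0 j) (du s 0 j).
      split; first by move/derivable_mxP: du1; exact.
      by move: du2; rewrite (derive_mx du1) => /rowP/(_ j); rewrite mxE.
    have : is_derive s (1 : R) (phi - sg \*: (fun s => u s 0 j)) (dphi s - sg *: du s 0 j).
      apply: is_deriveB; apply: is_deriveZ; exact: DeriveDef.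
    by [].
  have hc : {within `[0, t], continuous h}.
    apply: derivable_within_continuous => s; rewrite in_itv/= => st.
    by have [] := Dh s st.
  have [c + E] := MVT t0 (fun s st => Dh s (itvW s st)) hc.
  rewrite in_itv/= => ct.
  have h0 : 0 <= h t - h 0.
    rewrite E subr0 mulr_ge0// ?(ltW t0)// subr_ge0.
    apply: le_trans (le_du c ct); apply: le_trans (coord_le_norm _ j).
    by rewrite (le_trans (ler_norm _))// normrM sg1 mul1r.
  by rewrite -subr_ge0; move: h0; rewrite /h; congr (0 <= _); ring.
have phi0 : 0 <= phi t - phi 0.
  have hc : {within `[0, t], continuous phi}.
    apply: derivable_within_continuous => s; rewrite in_itv/= => st.
    by have [] := Dphi s st.
  have [c + ->] := MVT t0 (fun s st => Dphi s (itvW s st)) hc.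
  rewrite in_itv/= subr0 => ct; rewrite mulr_ge0// ?(ltW t0)//.
  exact: le_trans (le_du c ct).
apply: norm_le_coord => // j; rewrite !mxE ler_norml lerNl.
rewrite -[u t 0 j - _]mul1r -mulNr.
by apply/andP; split; apply: phi_incr; rewrite ?normrN normr1.
Qed.

(** At the infimum of the times of failure the property still holds, because it
    holds before; being open, it then holds a little longer, against the choice
    of the infimum. *)
Lemma first_exit (P : set R) (t : R) :
  (forall s, 0 <= s <= t -> P s -> \forall r \near s, P r) ->
  (forall s, 0 <= s <= t -> (forall r, 0 <= r < s -> P r) -> P s) ->
  forall s, 0 <= s <= t -> P s.
Proof.
move=> oP step s st; apply: contrapT => nPs.
pose A := [set r | 0 <= r <= s /\ ~ P r].
have hA : has_inf A.
  split; first by exists s; split=> //; case/andP: st => ->/=.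
  by exists 0 => r [/andP[]].
have inf0 : 0 <= inf A by apply: lb_le_inf => [|r [/andP[]]//]; case: hA.
have infs : inf A <= s.
  by apply: ge_inf; [case: hA|split=> //; case/andP: st => ->/=].
have inft : 0 <= inf A <= t by rewrite inf0 (le_trans infs)//; case/andP: st.
have Pinf : P (inf A).
  apply: step => //.
  move=> r /andP[r0 rA]; apply: contrapT => nPr.
  have : inf A <= r by apply: ge_inf; [case: hA|split=> //; rewrite r0 ltW// (lt_le_trans rA)].
  by rewrite leNgt rA.
have [e /= e0 eP] : nbhs_ball (inf A) P by apply/nbhs_ballP; exact: oP.
have [r Ar rA] := inf_adherent e0 hA; have [_ nPr] := Ar.
apply: nPr; apply: eP; rewrite /ball/= distrC ger0_norm.
  by rewrite ltrBlDl.
by rewrite subr_ge0; apply: ge_inf; case: hA.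
Qed.

Lemma is_derive_expRM (a c s : R) :
  is_derive s (1 : R) (fun t => a * expR (c * t)) (a * c * expR (c * s)).
Proof.
have -> : (fun t => a * expR (c * t)) = a \*: (expR \o ( *:%R c)) by [].
have Dc : is_derive s (1 : R) ( *:%R c : R -> R) c.
  have := @is_deriveZ _ _ _ (@id R) c s 1 1 (is_derive_id _ _).
  by move=> /is_derive_eq; apply; rewrite [LHS]mulr1.
have := @is_derive1_comp _ expR ( *:%R c) s _ _ _ Dc.
move=> /(_ _ (is_derive_expR _)) D.
by apply: is_derive_eq (is_deriveZ _ D) _; rewrite /= -[LHS]/(_ * (_ * _)); ring.
Qed.

(** Gronwall's inequality. The exponential on the right, slightly enlarged, is a
    barrier that [u] cannot be the first to reach, by the mean value inequality.
    The rate is [L + 1] instead of [L] so that the derivative of the barrier also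
    absorbs the constant [c]. *)
Lemma gronwall (u du : R -> 'rV[R]_n) (L c t : R) :
  0 <= L -> 0 <= c -> 0 <= t ->
  (forall s, 0 <= s <= t -> is_derive s (1 : R) u (du s)) ->
  (forall s, 0 <= s <= t -> `|du s| <= L * `|u s| + c) ->
  `|u t| <= (`|u 0| + c) * expR ((L + 1) * t).
Proof.
move=> L0 c0 t0 Du le_du.
have t_in : 0 <= t <= t by rewrite t0 lexx.
suff H eta : 0 < eta -> `|u t| < (`|u 0| + c + eta) * expR ((L + 1) * t).
  apply/ler_addgt0Pl => e e0; have := H _ (divr_gt0 e0 (expR_gt0 ((L + 1) * t))).
  by move=> /ltW; rewrite [X in _ <= X -> _]mulrDl divfK ?gt_eqF ?expR_gt0// addrC.
move=> eta0; set a := _ + eta; pose phi s := a * expR ((L + 1) * s).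
have Dphi s : is_derive s (1 : R) phi ((L + 1) * phi s).
  by apply: is_derive_eq (is_derive_expRM _ _ _) _; rewrite /phi; ring.
have a0 : 0 < a by rewrite /a ltr_wpDl// addr_ge0.
have le_phi s : 0 <= s -> a <= phi s.
  move=> s0; rewrite /phi ler_peMr ?(ltW a0)// -expR0 ler_expR mulr_ge0//.
  by rewrite addr_ge0.
rewrite -/(phi t); apply: (first_exit (P := fun s => `|u s| < phi s) (t := t)) => //.
  move=> s st us.
  have uc : {for s, continuous u}.
    by apply: differentiable_continuous; apply/derivable1_diffP; have [] := Du s st.
  have pc : {for s, continuous phi}.
    by apply: differentiable_continuous; apply/derivable1_diffP; have [] := Dphi s.
  have : {for s, continuous (fun r => phi r - `|u r|)}.
    by apply: continuousB => //; exact: (continuous_comp uc (@norm_continuous _ _ _)).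
  move=> /cvgr_gt/(_ 0); rewrite subr_gt0 => /(_ us).
  by apply: filterS => r /=; rewrite subr_gt0.
move=> s /andP[s0 st] IH.
have sub r : 0 <= r <= s -> 0 <= r <= t.
  by move=> /andP[-> rs]; rewrite (le_trans rs).
have := @mean_value_ineq u du phi (fun s => (L + 1) * phi s) s s0
  (fun r rs => Du r (sub r rs)) (fun r _ => Dphi r).
have phi0 : phi 0 = `|u 0| + c + eta by rewrite /phi mulr0 expR0 mulr1.
have step r : 0 < r < s -> `|du r| <= (L + 1) * phi r.
  move=> /andP[r0 rs]; apply: le_trans (le_du r _) _.
    by apply: sub; rewrite !ltW.
  rewrite mulrDl mul1r lerD// ?ler_wpM2l//; first by rewrite ltW// IH// (ltW r0).
  by apply: le_trans (le_phi r (ltW r0)); rewrite /a -addrA addrCA lerDl addr_ge0// ltW.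
move=> /(_ step) us.
have : `|u s| <= `|u s - u 0| + `|u 0| by rewrite -{1}[u s](subrK (u 0)) ler_normD.
lra.
Qed.

End calculus.

(** * Strict differentiability *)

Section strict_differentiability.
Variables (R : realType) (n : nat).
Implicit Types (u v : 'rV[R]_n).

Lemma is_derive_diff_comp (V W : normedModType R) (f : V -> W) (c : R -> V)
    (s : R) (dc : V) :
  is_derive s (1 : R) c dc -> differentiable f (c s) ->
  is_derive s (1 : R) (f \o c) ('d f (c s) dc).
Proof.
move=> [/derivable1_diffP cd ce] fd; split.
  exact/derivable1_diffP/differentiable_comp.
have dfc := differentiable_comp cd fd.
by rewrite (deriveE _ dfc) diff_comp//= -(deriveE _ cd) ce.
Qed.

Lemma continuous_dist (z0 : 'rV[R]_n) : continuous (fun z : 'rV[R]_n => `|z - z0|).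
Proof.
move=> z; have cB : {for z, continuous (fun z : 'rV[R]_n => z - z0)}.
  by apply: continuousB; [exact: cvg_id|exact: cst_continuous].
exact: (continuous_comp cB (@norm_continuous _ _ _)).
Qed.

Lemma linear_dist_bound (W : normedModType R) (f g : {linear 'rV[R]_n -> W})
    (eta : R) v :
  (forall j, `|f 'e_j - g 'e_j| <= eta) -> `|f v - g v| <= n%:R * eta * `|v|.
Proof.
move=> fg.
have -> : f v - g v = \sum_(j < n) v 0 j *: (f 'e_j - g 'e_j).
  have E (k : {linear 'rV[R]_n -> W}) : k v = \sum_(j < n) v 0 j *: k 'e_j.
    rewrite {1}[v]row_sum_delta linear_sum; apply: eq_bigr => j _.
    by rewrite linearZ.
  by rewrite !E -sumrB; apply: eq_bigr => j _; rewrite scalerBr.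
rewrite (le_trans (ler_norm_sum _ _ _))//.
rewrite -mulrA mulr_natl -[X in _ *+ X]card_ord -sumr_const ler_sum// => j _.
by rewrite normrZ mulrC ler_pM// coord_le_norm.
Qed.

Lemma diff_eps (V W : normedModType R) (f : V -> W) x eps :
  differentiable f x -> 0 < eps ->
  \forall y \near x, `|f y - f x - 'd f x (y - x)| <= eps * `|y - x|.
Proof.
move=> /diff_locallyP[_ /eqaddoP E] e0; have := E eps e0; rewrite near_simpl.
rewrite (near_shift x)/=.
by apply: filterS => y; rewrite sub0r !fctE/= subrK opprD addrA.
Qed.

Lemma diff_of_eps (V W : normedModType R) (f : V -> W) (L : {linear V -> W}) x :
  continuous L ->
  (forall eps, 0 < eps ->
     \forall y \near x, `|f y - f x - L (y - x)| <= eps * `|y - x|) ->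
  differentiable f x /\ 'd f x = L :> (V -> W).
Proof.
move=> cL fL.
have E : f \o shift x = cst (f x) + L +o_ 0 id.
  apply/eqaddoP => eps e0; rewrite near_simpl (near_shift x)/=.
  by apply: filterS (fL eps e0) => y; rewrite sub0r !fctE/= subrK opprD addrA.
have d := diff_unique cL E; split=> //; apply/diff_locallyP.
by rewrite d; split.
Qed.

Lemma diff_near_eq (V W : normedModType R) (f g : V -> W) x :
  differentiable f x -> (\forall y \near x, g y = f y) ->
  differentiable g x /\ 'd g x = 'd f x :> (V -> W).
Proof.
move=> df gf; apply: diff_of_eps; first exact: diff_continuous.
move=> eps e0; apply: filterS (filterI gf (diff_eps df e0)) => y [-> ].
by rewrite (nbhs_singleton gf).
Qed.

Lemma derive_dominated (r p : R -> 'rV[R]_n) dr dp eps :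
  is_derive 0 (1 : R) r dr -> is_derive 0 (1 : R) p dp ->
  (\forall s \near (0 : R), `|r s - r 0| <= eps * `|p s - p 0|) ->
  `|dr| <= eps * `|dp|.
Proof.
move=> [cr Er] [cp Ep] le.
have Fd : ProperFilter (0 : R)^' by exact: Proper_dnbhs_numFieldType.
have nr : (fun h : R => `|h^-1 *: ((r \o shift 0) (h *: (1 : R)) - r 0)|) @ (0 : R)^' --> `|dr|.
  by rewrite -Er; apply: cvg_norm; exact: cr.
have np : (fun h : R => eps * `|h^-1 *: ((p \o shift 0) (h *: (1 : R)) - p 0)|) @ (0 : R)^' --> eps * `|dp|.
  by apply: cvgMl_tmp; rewrite -Ep; apply: cvg_norm; exact: cp.
apply: (ler_cvg_to nr np).
apply: (nbhs_dnbhs (x := (0 : R))); apply: filterS le => s le_s.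
rewrite !normrZ mulrCA ler_wpM2l//= addr0.
by have -> : s *: (1 : R) = s by exact: mulr1.
Qed.

(** Strict differentiability of [C^1] maps: on a small ball the derivative is
    close to its value at [z0], and the mean value inequality along the segment
    from [z'] to [z] turns this into an estimate on increments. *)
Lemma C1_strict_diff (Y : 'rV[R]_n -> 'rV[R]_n) (U : set 'rV[R]_n) z0 eps :
  open U -> U z0 -> Ck 1 U Y -> 0 < eps ->
  exists2 rho, 0 < rho & forall z z', `|z - z0| <= rho -> `|z' - z0| <= rho ->
    U z /\ `|Y z - Y z' - 'd Y z0 (z - z')| <= eps * `|z - z'|.
Proof.
move=> oU Uz0 [dY cY] eps0; pose eta := eps / n.+1%:R.
have eta0 : 0 < eta by rewrite divr_gt0.
have : \forall w \near z0, U w /\ forall j : 'I_n, `|'D_'e_j Y w - 'D_'e_j Y z0| <= eta.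
  apply: filterI; first exact: open_nbhs_nbhs.
  apply: (@filter_forall _ _ (fun j w => `|'D_'e_j Y w - 'D_'e_j Y z0| <= eta) (nbhs z0)).
  move=> j.
  by have /cvgrPdistC_le/(_ eta eta0) := cY 'e_j z0 Uz0.
move=> /nbhs_ballP[r /= r0 rP]; exists (r / 2); first by rewrite divr_gt0.
have small w : `|w - z0| <= r / 2 ->
    U w /\ forall j : 'I_n, `|'D_'e_j Y w - 'D_'e_j Y z0| <= eta.
  move=> wr; apply: rP; rewrite -ball_normE/= distrC (le_lt_trans wr)//.
  by rewrite gtr_pMr// invf_lt1// ltr1n.
move=> z z' zr z'r; split; first by have [] := small z zr.
set h := z - z'; pose c (s : R) := z' + s *: h.
have cr s : 0 <= s <= 1 -> `|c s - z0| <= r / 2.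
  move=> /andP[s0 s1].
  have -> : c s - z0 = s *: (z - z0) + (1 - s) *: (z' - z0).
    by rewrite /c /h; apply/rowP => j; rewrite !mxE; ring.
  rewrite (le_trans (ler_normD _ _))// !normrZ !ger0_norm ?subr_ge0//.
  apply: (@le_trans _ _ (s * (r / 2) + (1 - s) * (r / 2))).
    by rewrite lerD// ler_wpM2l// subr_ge0.
  by rewrite -mulrDl subrKC mul1r.
pose u s := Y (c s) - s *: 'd Y z0 h.
have Dc (s : R) : is_derive s (1 : R) c h.
  have Dl : is_derive s (1 : R) ( *:%R^~ h : R -> 'rV[R]_n) h.
    split; first exact/diff_derivable.
    by rewrite deriveE// diff_val scale1r.
  by apply: is_derive_eq (is_deriveD (is_derive_cst z' s 1) Dl) _; rewrite add0r.
have Du (s : R) : 0 <= s <= 1 -> is_derive s (1 : R) u ('d Y (c s) h - 'd Y z0 h).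
  move=> s01; apply: is_deriveB.
    by apply: is_derive_diff_comp => //; apply: dY; case: (small (c s) (cr _ s01)).
  split; first exact/diff_derivable.
  by rewrite deriveE// diff_val scale1r.
have Dphi (s : R) : is_derive s (1 : R) (fun s : R => s *: (eps * `|h|)) (eps * `|h|).
  split; first exact/diff_derivable.
  by rewrite deriveE// diff_val scale1r.
have := @mean_value_ineq _ _ u _ (fun s : R => s *: (eps * `|h|)) _ 1 ler01 Du
  (fun s _ => Dphi s).
rewrite /u /c !scale1r !scale0r addr0 subr0 subrKC subr0 addrAC; apply.
move=> s /andP[s0 s1]; have s01 : 0 <= s <= 1 by rewrite !ltW.
have [Uc Dj] := small _ (cr s s01).
apply: le_trans (linear_dist_bound (eta := eta) _ _) _.
  by move=> j; have := Dj j; rewrite !deriveE//; exact: dY.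
rewrite ler_wpM2r// /eta mulrA ler_pdivrMr// mulrC ler_wpM2l// ?ltW//.
by rewrite ltr_nat.
Qed.

End strict_differentiability.

(** * Coordinate balls *)

Section charts.
Variables (R : realType) (n : nat) (M : manifold R n).
Implicit Types (i : chart_index M) (x y : M).

Lemma chartV_dom i z : (chart i @` dom i) z ->
  dom i (chartV i z) /\ chart i (chartV i z) = z.
Proof. by case=> x dx <-; rewrite chartK. Qed.

Lemma near_dom i x : dom i x -> \forall y \near x, dom i y.
Proof. by move=> dx; apply: open_nbhs_nbhs; split=> //; exact: open_dom. Qed.

Lemma near_image i x : dom i x -> \forall z \near chart i x, (chart i @` dom i) z.
Proof.
by move=> dx; apply: open_nbhs_nbhs; split; [exact: open_image|exists x].
Qed.

Lemma near_chart i x (P : set 'rV[R]_n) : dom i x -> nbhs (chart i x) P ->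
  \forall y \near x, dom i y /\ P (chart i y).
Proof. by move=> dx nP; apply: filterI; [exact: near_dom|exact: chart_continuous]. Qed.

Lemma near_chartV i x (P : set M) : dom i x -> nbhs x P ->
  \forall z \near chart i x, [/\ (chart i @` dom i) z & P (chartV i z)].
Proof.
move=> dx nP; have iz : (chart i @` dom i) (chart i x) by exists x.
have := @chartV_continuous _ _ _ _ _ iz; rewrite /prop_for /continuous_at chartK// => /(_ _ nP).
by move=> nP'; apply: filterS (filterI (near_image dx) nP') => z [].
Qed.

(** Continuity of [chart i] does not give this, since outside [dom i] it is
    arbitrary. The set is closed because it is the image under [chartV i] of a
    compact ball, in a Hausdorff space. *)
Lemma closed_chart_ball i (z0 : 'rV[R]_n) (rho : R) :
  (forall z, `|z - z0 : 'rV[R]_n| <= rho -> (chart i @` dom i) z) ->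
  closed [set y | dom i y /\ `|chart i y - z0| <= rho].
Proof.
move=> sub; pose B := [set z | `|z - z0| <= rho].
have -> : [set y | dom i y /\ `|chart i y - z0| <= rho] = chartV i @` B.
  apply/seteqP; split=> [y [dy yB]|_ [z zB <-]] /=; last first.
    by have [dz ->] := chartV_dom (sub _ zB).
  by exists (chart i y) => //; rewrite chartK.
apply: compact_closed; first exact: manifold_hausdorff.
apply: continuous_compact.
  apply: continuous_in_subspaceT => z; rewrite inE => zB.
  exact/chartV_continuous/sub.
apply: bounded_closed_compact.
  exists (`|z0| + rho); split; first exact: num_real.
  move=> r lt_r z zB; apply: le_trans (ltW lt_r).
  by rewrite -[z](subrKC z0) (le_trans (ler_normD _ _))// lerD2l.
have cN : continuous (fun z : 'rV[R]_n => `|z - z0|).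
  exact: continuous_dist.
have -> : B = (fun z : 'rV[R]_n => `|z - z0|) @^-1` [set r | r <= rho] by [].
by apply: preimage_closed; [move=> z _; exact: cN|exact: closed_le].
Qed.

(** The estimates on an integral curve hold as long as it stays in a closed
    coordinate ball; if they imply that it stays in the open ball, there is no
    first time of exit. Closedness of the ball in the manifold prevents the curve
    from leaving the domain of the chart by a jump of its coordinates. *)
Lemma trapping i (z0 : 'rV[R]_n) (rho t : R) (c : R -> M) :
  (forall z, `|z - z0 : 'rV[R]_n| <= rho -> (chart i @` dom i) z) ->
  continuous c -> dom i (c 0) -> `|chart i (c 0) - z0| < rho ->
  (forall s, 0 <= s <= t ->
    (forall r, 0 <= r <= s -> dom i (c r) /\ `|chart i (c r) - z0| <= rho) ->
    `|chart i (c s) - z0| < rho) ->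
  forall s, 0 <= s <= t -> dom i (c s) /\ `|chart i (c s) - z0| < rho.
Proof.
move=> sub cc d0 c0 step; apply: first_exit => [s st [ds cs]|s st IH].
  have cV : nbhs (chart i (c s)) [set z | `|z - z0| < rho].
    by have := @continuous_dist _ _ z0 => /(_ (chart i (c s)))/cvgr_lt; exact.
  by have := cc s _ (near_chart ds cV).
have [s0|s0] := eqVneq s 0; first by rewrite s0.
have {}s0 : 0 < s by rewrite lt_neqAle eq_sym s0; case/andP: st.
have cs : dom i (c s) /\ `|chart i (c s) - z0| <= rho.
  have cs' : c r @[r --> s^'-] --> c s by apply: cvg_at_left_filter; exact: cc.
  apply: (closed_cvg _ (closed_chart_ball sub) _ _ cs').
    near=> r; have [|? ?] := IH r; last by split=> //; exact: ltW.
    by apply/andP; split; near: r; [apply: filterS (nbhs_left_gt s0) => ? /ltW|exact: nbhs_left_lt].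
have [ds _] := cs; split=> //; apply: step => // r /andP[r0].
rewrite le_eqVlt => /predU1P[->//|rs].
by have [|dr cr] := IH r; [rewrite r0|split=> //; exact: ltW].
Unshelve. all: by end_near. Qed.

Lemma chart_ball_sub i x (P : set M) : dom i x -> nbhs x P ->
  exists2 r, 0 < r & forall y, dom i y -> `|chart i y - chart i x| < r -> P y.
Proof.
move=> dx nP; have := near_chartV dx nP; move=> /nbhs_ballP[r /= r0 rP].
exists r => // y dy yr.
have [|_] := rP (chart i y); last by rewrite chartK.
by rewrite -ball_normE/= distrC.
Qed.
Lemma tcoord_chart_at x (v : tangent x) : tcoord (chart_at x) x v = v.
Proof.
rewrite /tcoord; set i := chart_at x; have dx : dom i x := dom_chart_at x.
have E : \forall z \near chart i x, (chart i \o chartV i) z = id z.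
  by near=> z; have /chartV_dom[] : (chart i @` dom i) z by near: z; exact: near_image.
have did : differentiable (id : 'rV[R]_n -> 'rV[R]_n) (chart i x) by [].
by have [_ ->] := diff_near_eq did E; rewrite diff_val.
Unshelve. all: by end_near. Qed.

End charts.

(** * Integral curves *)

Section integral_curves.
Variables (R : realType) (n : nat) (M : manifold R n).
Implicit Types (i : chart_index M) (x y : M) (X : flow M).

Definition local_field X i (z : 'rV[R]_n) : 'rV[R]_n :=
  tcoord i _ (field X (chartV i z)).

Lemma local_fieldE X i x : dom i x ->
  local_field X i (chart i x) = tcoord i _ (field X x).
Proof. by move=> dx; rewrite /local_field chartK. Qed.

(** Continuity is required separately for the same reason as in [flow_of]. *)
Definition integral_curve X (c : R -> M) : Prop :=
  continuous c /\ forall t i, dom i (c t) ->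
    is_derive t (1 : R) (fun s => chart i (c s)) (local_field X i (chart i (c t))).

Lemma integral_curve_flow X x : integral_curve X (X ^~ x).
Proof.
have [_ cX dX] := trajectoryP X; split=> [|t i dt]; first exact: cX.
by rewrite local_fieldE//; exact: dX.
Qed.

Lemma integral_curve_shift X c a : integral_curve X c ->
  integral_curve X (fun t => c (t + a)).
Proof.
move=> [cc dc]; split=> [t|t i dt].
  apply: (@continuous_comp _ _ _ (fun t => t + a) c); last exact: cc.
  by apply: cvgD; [exact: cvg_id|exact: cvg_cst].
have Da : is_derive t (1 : R) (shift a : R -> R) 1 := is_derive_shift _ _ _.
have Dc := dc _ _ dt.
have Ec : differentiable (fun s => chart i (c s)) (shift a t).
  by apply/derivable1_diffP; case: Dc.
apply: is_derive_eq (is_derive_diff_comp Da Ec) _.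
by rewrite -(deriveE _ Ec); case: Dc.
Qed.

Lemma integral_curve_reverse X c : integral_curve X c ->
  integral_curve (reverse X) (fun t => c (- t)).
Proof.
move=> [cc dc]; split=> [t|t i dt].
  by apply: (@continuous_comp _ _ _ -%R c); [exact: oppr_continuous|exact: cc].
have DN : is_derive t (1 : R) (-%R : R -> R) (- 1) := is_deriveNid _ _.
have Dc := dc _ _ dt.
have Ec : differentiable (fun s => chart i (c s)) (- t).
  by apply/derivable1_diffP; case: Dc.
apply: is_derive_eq (is_derive_diff_comp DN Ec) _.
rewrite linearN -(deriveE _ Ec) (@derive_val _ _ _ _ _ _ _ Dc).
by rewrite /local_field /= /tcoord linearN.
Qed.

Lemma local_field_strict_diff X i x eps : dom i x -> 0 < eps ->
  exists2 rho, 0 < rho & forall z z', `|z - chart i x| <= rho ->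
    `|z' - chart i x| <= rho -> (chart i @` dom i) z /\
    `|local_field X i z - local_field X i z'
       - 'd (local_field X i) (chart i x) (z - z')| <= eps * `|z - z'|.
Proof.
move=> dx; apply: C1_strict_diff; [exact: open_image|by exists x|].
exact: field_C1.
Qed.

Lemma local_field_lipschitz X i x : dom i x ->
  exists rho L, [/\ 0 < rho, 0 <= L & forall z z', `|z - chart i x| <= rho ->
    `|z' - chart i x| <= rho -> (chart i @` dom i) z /\
    `|local_field X i z - local_field X i z'| <= L * `|z - z'|].
Proof.
move=> dx; have [rho rho0 sd] := local_field_strict_diff X dx ltr01.
have [C C0 AC] := linear_bounded ('d (local_field X i) (chart i x)).
exists rho, (1 + C); split=> //; first by rewrite addr_ge0// ltW.
move=> z z' zr z'r; have [iz le] := sd z z' zr z'r; split=> //.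
rewrite mulrDl; apply: le_trans (lerD le (AC _)).
by rewrite -{1}[_ - local_field X i z'](subrK ('d (local_field X i) (chart i x) (z - z'))) ler_normD.
Qed.

(** This local estimate gives both uniqueness of integral curves and continuity
    of the flow. The field is bounded by [S] and Lipschitz on a coordinate ball of
    radius [rho], so a curve that starts in the ball of half the radius needs a
    time at least [rho / (2 * S)] to leave, and until then Gronwall's inequality
    applies to the difference of two curves. *)
Lemma integral_curves_near X x : exists U delta C, [/\ nbhs x U, 0 < delta &
  forall c c', integral_curve X c -> integral_curve X c' ->
    U (c 0) -> U (c' 0) -> forall t, 0 <= t <= delta ->
    let i := chart_at x in
    [/\ dom i (c t), dom i (c' t) &
      `|chart i (c t) - chart i (c' t)| <= C * `|chart i (c 0) - chart i (c' 0)|]].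
Proof.
set i := chart_at x; have dx : dom i x := dom_chart_at x.
have [rho [L [rho0 L0 lip]]] := local_field_lipschitz X dx.
set z0 := chart i x in lip *; set Y := local_field X i in lip *.
pose S := `|Y z0| + L * rho + 1.
have S0 : 0 < S by rewrite ltr_pwDr// addr_ge0// mulr_ge0// ltW.
have z0r : `|z0 - z0| <= rho by rewrite subrr normr0 ltW.
have YS z : `|z - z0| <= rho -> `|Y z| <= S.
  move=> zr; have [_ le] := lip z z0 zr z0r.
  rewrite -[Y z](subrKC (Y z0)) (le_trans (ler_normD _ _))// /S -addrA lerD2l.
  by rewrite (le_trans le)// (le_trans (ler_wpM2l L0 zr))// lerDl.
have im z : `|z - z0| <= rho -> (chart i @` dom i) z by move=> zr; case: (lip z z0 zr z0r).
pose U := [set y | dom i y /\ `|chart i y - z0| < rho / 2].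
pose delta := rho / (2 * S).
have delta0 : 0 < delta by rewrite divr_gt0// mulr_gt0.
exists U, delta, (expR ((L + 1) * delta)); split=> //.
  apply: (near_chart (P := [set z | `|z - z0| < rho / 2]) dx).
  apply: (@continuous_dist _ _ z0 z0 [set r | r < rho / 2]).
  by apply: lt_nbhsl; rewrite subrr normr0 divr_gt0.
have stay c : integral_curve X c -> U (c 0) -> forall t, 0 <= t <= delta ->
    dom i (c t) /\ `|chart i (c t) - z0| < rho.
  move=> [cc Dc] [d0 c0]; apply: trapping => //.
    by apply: lt_trans c0 _; lra.
  move=> s /andP[s0 sd] IH.
  have le1 : `|chart i (c s) - chart i (c 0)| <= S * s - S * 0.
    apply: (@mean_value_ineq _ _ (fun s => chart i (c s)) (fun s => Y (chart i (c s)))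
      (fun s => S * s) (fun=> S)) => //.
    - by move=> r rs; apply: Dc; case: (IH r rs).
    - move=> r _; have := @is_deriveZ _ _ _ (@id R) S r 1 1 (is_derive_id _ _).
      by move=> /is_derive_eq; apply; rewrite [LHS]mulr1.
    - move=> r /andP[r0 rs]; apply: YS.
      by case: (IH r) => //; rewrite (ltW r0) (ltW rs).
  have le2 : S * s <= rho / 2.
    have -> : rho / 2 = S * delta by rewrite /delta; field; rewrite gt_eqF.
    by rewrite ler_wpM2l// ltW.
  rewrite -[chart i (c s)](subrK (chart i (c 0))) -addrA.
  rewrite (le_lt_trans (ler_normD _ _))//.
  by move: le1 c0 le2; rewrite mulr0; lra.
move=> c c' ic ic' Uc Uc' t td /=.
have [dt ct] := stay c ic Uc t td; have [dt' ct'] := stay c' ic' Uc' t td.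
split=> //; have /andP[t0 tdelta] := td.
have sub s : 0 <= s <= t -> 0 <= s <= delta.
  by move=> /andP[-> st]; rewrite (le_trans st).
have := @gronwall _ _ (fun s => chart i (c s) - chart i (c' s))
   (fun s => Y (chart i (c s)) - Y (chart i (c' s))) L 0 t L0 (lexx 0) t0.
rewrite addr0 => G; apply: le_trans (G _ _) _.
- move=> s /sub sd; apply: is_deriveB.
    by apply: ic.2; case: (stay c ic Uc s sd).
  by apply: ic'.2; case: (stay c' ic' Uc' s sd).
- move=> s /sub sd; rewrite addr0.
  have [_ cs] := stay c ic Uc s sd; have [_ cs'] := stay c' ic' Uc' s sd.
  by case: (lip _ _ (ltW cs) (ltW cs')).
- by rewrite mulrC ler_wpM2r// ler_expR ler_wpM2l// addr_ge0.
Qed.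

End integral_curves.

(** * The flow as a group of homeomorphisms *)

Section flows.
Variables (R : realType) (n : nat) (M : manifold R n).
Hypothesis Mc : compact [set: M].
Implicit Types (i : chart_index M) (x y : M) (X : flow M).

(** Compactness makes the duration of the local estimates uniform. From there on
    uniqueness and continuity extend to all times by finitely many steps of
    length [delta]. *)
Lemma uniform_time X : exists2 delta, 0 < delta & forall x,
  (forall c c', integral_curve X c -> integral_curve X c' -> c 0 = x -> c' 0 = x ->
     forall t, 0 <= t <= delta -> c t = c' t) /\
  (forall t, 0 <= t <= delta -> {for x, continuous (X t)}).
Proof.
pose P (delta : R) x :=
  (forall c c', integral_curve X c -> integral_curve X c' -> c 0 = x -> c' 0 = x ->
     forall t, 0 <= t <= delta -> c t = c' t) /\
  (forall t, 0 <= t <= delta -> {for x, continuous (X t)}).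
have cover x : [set: M] x -> \forall y \near x & delta \near 0^'+, P delta y.
  move=> _; have [U [delta [C [nU delta0 H]]]] := integral_curves_near X x.
  set i := chart_at x in H.
  have {}nU := nbhs_interior nU.
  exists (U°, [set d | d <= delta]); first split=> //=.
    exact: nbhs_right_le.
  move=> [y d] /= [Uy dd].
  have le_delta t : 0 <= t <= d -> 0 <= t <= delta.
    by move=> /andP[-> td]; rewrite (le_trans td).
  have Uy' : U y := interior_subset Uy.
  split=> [c c' ic ic' cy c'y t /le_delta td|t /le_delta td].
    have [||dt dt'] := H c c' ic ic' _ _ t td; rewrite ?cy ?c'y//.
    rewrite subrr normr0 mulr0 normr_le0 subr_eq0 => /eqP ct.
    by rewrite -(chartK dt) ct chartK.
  have X0 z : X 0 z = z by case: (trajectoryP X).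
  have Ht z : U z -> [/\ dom i (X t y), dom i (X t z) &
      `|chart i (X t y) - chart i (X t z)| <= C * `|chart i y - chart i z|].
    move=> Uz.
    have := H _ _ (integral_curve_flow X y) (integral_curve_flow X z).
    by rewrite !X0; exact.
  have [dty _ _] := Ht y Uy'.
  have dy : dom i y.
    have := H _ _ (integral_curve_flow X y) (integral_curve_flow X y).
    by rewrite !X0 => /(_ Uy' Uy' 0); rewrite lexx ltW// X0 => -[].
  have nUy : nbhs y U by exact: Uy.
  have cX : chart i (X t z) @[z --> y] --> chart i (X t y).
    apply/cvgrPdist_le => eps eps0.
    have C0 : 0 < `|C| + 1 by rewrite ltr_wpDl.
    have /cvgrPdist_le/(_ (eps / (`|C| + 1))) := chart_continuous dy.
    rewrite divr_gt0// => /(_ isT) cy.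
    apply: filterS (filterI nUy cy) => z [Uz le]; have [_ _ /le_trans] := Ht z Uz.
    apply; apply: (@le_trans _ _ ((`|C| + 1) * `|chart i y - chart i z|)).
      by rewrite ler_wpM2r// (le_trans (ler_norm _))// lerDl.
    by rewrite mulrC -ler_pdivlMr.
  move=> V; rewrite -{1}(chartK dty) => nV.
  have iz : (chart i @` dom i) (chart i (X t y)) by exists (X t y).
  have := cX _ (chartV_continuous iz nV).
  move=> nV'; apply: filterS (filterI nUy nV') => z [Uz /=].
  by have [_ dtz _] := Ht z Uz; rewrite chartK.
have := (compact_near_coveringP _).1 Mc _ _ P _ cover.
move=> nP; have /filter_ex[d [d0 dP]] : \forall d \near (0:R)^'+, 0 < d /\ [set: M] `<=` P d.
  by apply: filterI; [exact: nbhs_right_gt|exact: nP].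
by exists d => // x; exact: dP.
Qed.

Lemma integral_curve_unique_ge0 X c c' : integral_curve X c -> integral_curve X c' ->
  c 0 = c' 0 -> forall t, 0 <= t -> c t = c' t.
Proof.
have [d d0 dP] := uniform_time X.
move=> ic ic' c0; suff H N t : 0 <= t <= d *+ N -> c t = c' t.
  move=> t t0; apply: (H (Num.truncn (t / d)).+1); rewrite t0/= -mulr_natl.
  by rewrite -ler_pdivrMr// ltW// Num.Theory.truncnS_gt.
elim: N t => [t|N IH t /andP[t0 tN]].
  by rewrite mulr0n => t0; have -> : t = 0 by apply/eqP; rewrite eq_le andbC.
have [td|dt] := leP t d.
  by apply: (dP (c 0)).1; rewrite ?t0.
have E : c (t - d) = c' (t - d).
  by apply: IH; rewrite subr_ge0 ltW//= lerBlDr -mulrSr.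
have := (dP (c (t - d))).1 _ _ (integral_curve_shift (t - d) ic)
  (integral_curve_shift (t - d) ic').
rewrite !add0r => /(_ erefl (esym E) d); rewrite lexx ltW// subrKC; exact.
Qed.

Lemma integral_curve_unique X c c' : integral_curve X c -> integral_curve X c' ->
  c 0 = c' 0 -> c = c'.
Proof.
move=> ic ic' c0; apply/funext => t; have [t0|t0] := leP 0 t.
  exact: (integral_curve_unique_ge0 ic ic' c0 t0).
rewrite -[t]opprK; apply: (integral_curve_unique_ge0 (integral_curve_reverse ic)
  (integral_curve_reverse ic')); first by rewrite oppr0.
by rewrite oppr_ge0 ltW.
Qed.

Lemma flow0 X x : X 0 x = x. Proof. by case: (trajectoryP X). Qed.

(** Both sides are integral curves of [s] with the same initial point. *)
Lemma flowD X s t x : X (s + t) x = X s (X t x).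
Proof.
have := integral_curve_unique (integral_curve_shift t (integral_curve_flow X x))
  (integral_curve_flow X (X t x)).
by rewrite add0r flow0 => /(_ erefl)/(congr1 (@^~ s)).
Qed.

Lemma flowNK X t x : X (- t) (X t x) = x.
Proof. by rewrite -flowD addNr flow0. Qed.

Lemma flowKN X t x : X t (X (- t) x) = x.
Proof. by rewrite -flowD subrr flow0. Qed.

Lemma flow_continuous_ge0 X t : 0 <= t -> continuous (X t).
Proof.
have [d d0 dP] := uniform_time X.
suff H N u : 0 <= u <= d *+ N -> continuous (X u).
  move=> t0; apply: (H (Num.truncn (t / d)).+1); rewrite t0/= -mulr_natl.
  by rewrite -ler_pdivrMr// ltW// Num.Theory.truncnS_gt.
elim: N u => [u|N IH u /andP[u0 uN]].
  move=> u0; have -> : u = 0 by apply/eqP; rewrite eq_le andbC.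
  by move=> x; apply: (dP x).2; rewrite lexx ltW.
have [ud|du] := leP u d; first by move=> x; apply: (dP x).2; rewrite u0.
move=> x; have -> : X u = X d \o X (u - d).
  by apply/funext => y /=; rewrite -flowD subrKC.
apply: continuous_comp.
  by apply: IH; rewrite subr_ge0 ltW//= lerBlDr -mulrSr.
by apply: (dP _).2; rewrite lexx ltW.
Qed.

Lemma flow_continuous X t : continuous (X t).
Proof.
have [t0|t0] := leP 0 t; first exact: flow_continuous_ge0.
have -> : X t = reverse X (- t) by apply/funext => x /=; rewrite opprK.
by apply: flow_continuous_ge0; rewrite oppr_ge0 ltW.
Qed.

End flows.

(** * Tangent maps *)

Section tangent_maps.
Variables (R : realType) (n : nat) (M : manifold R n).
Implicit Types (i : chart_index M) (x y : M).

Definition chart_map (f : M -> M) x : 'rV[R]_n -> 'rV[R]_n :=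
  chart (chart_at (f x)) \o f \o chartV (chart_at x).

Definition differentiable_at (f : M -> M) x : Prop :=
  differentiable (chart_map f x) (chart (chart_at x) x).

Lemma tmapE f x v : tmap f x v = 'd (chart_map f x) (chart (chart_at x) x) v.
Proof. by rewrite /tmap lfunE. Qed.

(** Where a map is not differentiable, its ['d] is the zero map by convention. It
    follows that the flow is differentiable at the points of every invariant set
    over which the tangent bundle has an invariant splitting. *)
Lemma onto_differentiable f x : (tmap f x @: fullv)%VS = fullv -> differentiable_at f x.
Proof.
move=> onto; apply: contrapT => nd.
have d0 : 'd (chart_map f x) (chart (chart_at x) x) = \0 :> (_ -> _).
  rewrite /diff; set P := (X in get X).
  have [exP|nP] := pselect (exists df, P df); last first.
    by rewrite getPN// => df Pdf; apply: nP; exists df.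
  by case: nd; apply/diffP; exact: (getPex exP).
have v0 (v : 'rV[R]_n) : v = 0.
  have : v \in (tmap f x @: fullv)%VS by rewrite onto memvf.
  by move=> /memv_imgP[w _ ->]; rewrite tmapE d0.
apply: nd; rewrite /differentiable_at.
have -> : chart_map f x = cst 0 by apply/funext => z; rewrite [LHS]v0.
exact: differentiable_cst.
Qed.

Lemma tmap_comp f h x : {for x, continuous f} ->
  differentiable_at f x -> differentiable_at h (f x) ->
  forall v, tmap (h \o f) x v = tmap h (f x) (tmap f x v).
Proof.
move=> cf df dh v; apply: etrans (tmapE (h \o f) x v) _.
apply: etrans (esym (tmapE h (f x) (tmap f x v))).
apply: etrans (congr1 ('d (chart_map h (f x)) (chart (chart_at (f x)) (f x))) (esym (tmapE f x v))).
have dx := dom_chart_at x; have dfx := dom_chart_at (f x).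
have E0 : chart_map f x (chart (chart_at x) x) = chart (chart_at (f x)) (f x).
  by rewrite /chart_map/= chartK.
have dh' : differentiable (chart_map h (f x)) (chart_map f x (chart (chart_at x) x)).
  by rewrite E0.
have dc := differentiable_comp df dh'.
have near_comp : \forall z \near chart (chart_at x) x,
    chart_map (h \o f) x z = (chart_map h (f x) \o chart_map f x) z.
  near=> z; have [_ fz] : [/\ (chart (chart_at x) @` dom (chart_at x)) z &
      (f @^-1` dom (chart_at (f x))) (chartV (chart_at x) z)].
    by near: z; apply: near_chartV => //; apply: cf; exact: near_dom.
  by rewrite /chart_map/= chartK.
have [_ Ed] := diff_near_eq dc near_comp.
apply: etrans (congr1 (@^~ v) Ed) _.
apply: etrans (congr1 (@^~ v) (diff_comp df dh')) _.
by rewrite /= E0.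
Unshelve. all: by end_near. Qed.

Lemma tmap_id x (v : tangent x) : tmap id x v = v.
Proof. by rewrite tmapE; exact: tcoord_chart_at. Qed.

Lemma tvecK i x : dom i x -> cancel (tcoord i x) (tvec i x).
Proof.
move=> di v; rewrite /tcoord /tvec; set j := chart_at x.
have dj : dom j x := dom_chart_at x.
have sm k l : dom k x -> dom l x -> differentiable (chart l \o chartV k) (chart k x).
  move=> dk dl; have [+ _] := @transition_smooth _ _ M k l 1.
  by apply; exists x.
have d1 := sm j i dj di; have d2 := sm i j di dj.
have Ex : chart i x = (chart i \o chartV j) (chart j x) by rewrite /= chartK.
rewrite {}Ex in d2 *.
apply: etrans (esym (congr1 (@^~ v) (diff_comp d1 d2))) _.
have did : differentiable (id : 'rV[R]_n -> 'rV[R]_n) (chart j x) by [].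
have near_id : \forall z \near chart j x,
    ((chart j \o chartV i) \o (chart i \o chartV j)) z = id z.
  near=> z.
  have [jz iz] : [/\ (chart j @` dom j) z & dom i (chartV j z)].
    by near: z; apply: near_chartV => //; exact: near_dom.
  by rewrite /= chartK//; case: (chartV_dom jz).
have [_ Ed] := diff_near_eq did near_id.
by apply: etrans (congr1 (@^~ v) Ed) _; rewrite diff_val.
Unshelve. all: by end_near. Qed.

End tangent_maps.

(** * Riemannian norms and areas *)

Section metric_theory.
Variables (R : realType) (n : nat) (M : manifold R n) (g : metric M).
Implicit Types (x y : M).

Lemma innerDl x (u v w : tangent x) : g x (u + v : 'rV_n) w = g x u w + g x v w.
Proof. by rewrite -[u : 'rV_n]scale1r inner_linear mul1r scale1r. Qed.

Lemma inner0l x (w : tangent x) : g x (0 : 'rV_n) w = 0.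
Proof.
by apply: (addrI (g x (0 : 'rV_n) w)); rewrite -innerDl !addr0.
Qed.

Lemma innerZl x a (u w : tangent x) : g x (a *: u : 'rV_n) w = a * g x u w.
Proof. by rewrite -[a *: _ : 'rV_n]addr0 inner_linear inner0l addr0. Qed.

Lemma innerDr x (u v w : tangent x) : g x w (u + v : 'rV_n) = g x w u + g x w v.
Proof. by rewrite inner_sym innerDl !(inner_sym _ w). Qed.

Lemma innerZr x a (u w : tangent x) : g x w (a *: u : 'rV_n) = a * g x w u.
Proof. by rewrite inner_sym innerZl inner_sym. Qed.

Lemma innerNl x (u w : tangent x) : g x (- u : 'rV_n) w = - g x u w.
Proof. by rewrite -scaleN1r innerZl mulN1r. Qed.

Lemma innerNr x (u w : tangent x) : g x w (- u : 'rV_n) = - g x w u.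
Proof. by rewrite inner_sym innerNl inner_sym. Qed.

Lemma inner_ge0 x (u : tangent x) : 0 <= g x u u.
Proof.
have [->|u0] := eqVneq (u : 'rV_n) 0; first by rewrite inner0l.
exact/ltW/inner_pos.
Qed.

(** The vector [w] is the component of [u] orthogonal to [v]. The identity yields
    the Cauchy-Schwarz inequality as well as the positivity of areas. *)
Lemma inner_defect x (u v : tangent x) : (v : 'rV_n) != 0 ->
  let w : 'rV_n := u - (g x u v / g x v v) *: v in
  g x u u * g x v v - g x u v ^+ 2 = g x v v * g x w w.
Proof.
move=> v0 w; have gv := @inner_pos _ _ _ g x _ v0; rewrite /w.
rewrite innerDl !innerDr !innerNl !innerNr !innerZl !innerZr (inner_sym g v u); field.
by rewrite gt_eqF.
Qed.

Lemma cauchy_schwarz x (u v : tangent x) : g x u v ^+ 2 <= g x u u * g x v v.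
Proof.
rewrite -subr_ge0; have [->|v0] := eqVneq (v : 'rV_n) 0.
  by rewrite inner_sym !inner0l mulr0 expr0n subrr.
by rewrite inner_defect// mulr_ge0// inner_ge0.
Qed.

Lemma tnorm_ge0 x (u : tangent x) : 0 <= tnorm g x u.
Proof. exact: sqrtr_ge0. Qed.

Lemma tnorm0 x : tnorm g x (0 : 'rV_n) = 0.
Proof. by rewrite /tnorm inner0l sqrtr0. Qed.

Lemma tnorm_gt0 x (u : tangent x) : (u : 'rV_n) != 0 -> 0 < tnorm g x u.
Proof. by move=> u0; rewrite sqrtr_gt0 inner_pos. Qed.

Lemma tnormZ x a (u : tangent x) : tnorm g x (a *: u : 'rV_n) = `|a| * tnorm g x u.
Proof.
by rewrite /tnorm innerZl innerZr mulrA -expr2 sqrtrM ?sqr_ge0// sqrtr_sqr.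
Qed.

Lemma tnormD x (u v : tangent x) :
  tnorm g x (u + v : 'rV_n) <= tnorm g x u + tnorm g x v.
Proof.
rewrite -(ger0_norm (tnorm_ge0 (u + v : 'rV_n))) -ler_sqr ?nnegrE//; last first.
  by rewrite addr_ge0 ?tnorm_ge0.
rewrite real_normK ?num_real// sqrrD !sqr_sqrtr ?inner_ge0//.
rewrite innerDl !innerDr (inner_sym g v u) -mulrnAl.
have : g x u v <= tnorm g x u * tnorm g x v.
  rewrite -sqrtrM ?inner_ge0// (le_trans (ler_norm _))//.
  by rewrite -sqrtr_sqr ler_wsqrtr// cauchy_schwarz.
rewrite /tnorm; lra.
Qed.

Lemma tnormN x (u : tangent x) : tnorm g x (- u : 'rV_n) = tnorm g x u.
Proof. by rewrite -scaleN1r tnormZ normrN1 mul1r. Qed.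

Lemma tnorm_sum x (I : finType) (w : I -> tangent x) :
  tnorm g x (\sum_i (w i : 'rV_n)) <= \sum_i tnorm g x (w i).
Proof.
elim/big_ind2 : _ => [|u a v b ua vb|//]; first by rewrite tnorm0.
exact: le_trans (tnormD _ _) (lerD ua vb).
Qed.

Lemma area_gt0 x (u v : tangent x) : (v : 'rV_n) != 0 ->
  (forall a, (u : 'rV_n) != a *: v) -> 0 < area g x u v.
Proof.
move=> v0 uv; rewrite /area sqrtr_gt0 inner_defect// mulr_gt0//; apply: inner_pos => //.
by rewrite subr_eq0.
Qed.

(** The norms of the coordinate vectors are continuous functions of the base
    point, hence bounded near [x]; the triangle inequality does the rest. *)
Lemma tnorm_near x : exists2 C, 0 < C & \forall y \near x,
  dom (chart_at x) y /\
  forall v : tangent y, tnorm g y v <= C * `|tcoord (chart_at x) y v|.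
Proof.
set i := chart_at x; have dx : dom i x := dom_chart_at x.
pose B := 1 + \sum_(k < n) (g x (tvec i x 'e_k) (tvec i x 'e_k) + 1).
have B0 : 0 < B.
  by rewrite ltr_pwDl// sumr_ge0// => k _; rewrite addr_ge0// inner_ge0.
exists (n%:R * Num.sqrt B + 1); first by rewrite ltr_wpDl// mulr_ge0// sqrtr_ge0.
have nB : \forall y \near x, forall k : 'I_n,
    g y (tvec i y 'e_k) (tvec i y 'e_k) <= B.
  apply: (@filter_forall _ _ (fun k y => g y (tvec i y 'e_k) (tvec i y 'e_k) <= B) (nbhs x)).
  move=> k; pose h z := g (chartV i z) (tvec i _ 'e_k) (tvec i _ 'e_k).
  have hx : h (chart i x) < B.
    rewrite /h chartK// /B (bigD1 k)//= addrA ltr_wpDr//; last by lra.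
    by rewrite sumr_ge0// => l _; rewrite addr_ge0// inner_ge0.
  have ch : {for chart i x, continuous h}.
    by apply: (@inner_smooth _ _ _ g i 'e_k 'e_k 0); exists x.
  have nh := near_chart (P := [set z | h z < B]) dx (cvgr_lt _ ch _ hx).
  near=> y; have [dy] : dom i y /\ h (chart i y) < B by near: y; exact: nh.
  move=> /ltW; have -> : h (chart i y) = g y (tvec i y 'e_k) (tvec i y 'e_k).
    by rewrite /h chartK.
  exact.
near=> y; have dy : dom i y by near: y; exact: near_dom.
have le_B : forall k : 'I_n, g y (tvec i y 'e_k) (tvec i y 'e_k) <= B.
  by near: y; exact: nB.
split=> // v.
rewrite -{1}(tvecK dy v); set w := tcoord i y v.
have -> : tvec i y w = \sum_(k < n) w 0 k *: (tvec i y 'e_k : 'rV_n).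
  rewrite {1}[w]row_sum_delta /tvec linear_sum; apply: eq_bigr => k _.
  exact: linearZ.
apply: le_trans (tnorm_sum _) _.
rewrite mulrDl ler_wpDr ?mul1r//.
rewrite -mulrA mulr_natl -[X in _ *+ X]card_ord -sumr_const ler_sum// => k _.
rewrite tnormZ mulrC ler_pM ?tnorm_ge0// ?coord_le_norm//.
by rewrite /tnorm ler_wsqrtr.
Unshelve. all: by end_near. Qed.

Lemma tnorm_le x : exists2 C, 0 < C & forall v : tangent x,
  tnorm g x v <= C * `|v : 'rV_n|.
Proof.
have [C C0 /nbhs_singleton[_ le]] := tnorm_near x; exists C => // v.
by have := le v; rewrite tcoord_chart_at.
Qed.

(** The constant is the minimum of the norm over the unit sphere. *)
Lemma tnorm_ge x : exists2 c, 0 < c & forall v : tangent x,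
  c * `|v : 'rV_n| <= tnorm g x v.
Proof.
have [C C0 leC] := tnorm_le x.
pose S := [set v : 'rV[R]_n | `|v| = 1].
have [S0|/set0P S0] := eqVneq S set0.
  exists 1 => // v; have [->|v0] := eqVneq (v : 'rV_n) 0.
    by rewrite normr0 mulr0 tnorm_ge0.
  have : S (`|v : 'rV_n|^-1 *: (v : 'rV_n)).
    by rewrite /S/= normrZ normfV normr_id mulVf// normr_eq0.
  by rewrite S0.
have cS : compact S.
  apply: bounded_closed_compact.
    by exists 1; split; [exact: num_real|move=> r /ltW r1 v /= ->].
  have -> : S = (fun v : 'rV[R]_n => `|v|) @^-1` [set 1] by [].
  apply: preimage_closed; last exact: closed_eq.
  by move=> v _; exact: norm_continuous.
have ct : continuous (fun v : 'rV[R]_n => tnorm g x v).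
  move=> v; have Fv : Filter (nbhs v) := nbhs_filter v.
  apply/(@cvgrPdist_le _ _ _ _ Fv) => eps eps0.
  have e0 : 0 < eps / C by rewrite divr_gt0.
  have := cvgr_lt _ (@continuous_dist R n v v) (eps / C).
  rewrite subrr normr0 => /(_ Fv e0).
  apply: filterS => w /ltW le.
  have tD (a b : 'rV[R]_n) : `|a - b| <= eps / C -> tnorm g x a <= tnorm g x b + eps.
    rewrite ler_pdivlMr// mulrC => ab; rewrite -{1}[a](subrKC b).
    by rewrite (le_trans (tnormD _ _))// lerD2l (le_trans (leC _)).
  rewrite ler_distl; apply/andP; split; last by apply: tD; rewrite distrC.
  by rewrite lerBlDr; exact: tD.
have [v0 Sv0 minv] := EVT_min_rV S0 cS (continuous_subspaceT ct).
rewrite inE in Sv0.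
have v00 : v0 != 0 by rewrite -normr_eq0 Sv0 oner_eq0.
exists (tnorm g x v0); first exact: tnorm_gt0.
move=> v; have [->|vn0] := eqVneq (v : 'rV_n) 0; first by rewrite normr0 mulr0 tnorm_ge0.
have v1 : 0 < `|v : 'rV_n| by rewrite normr_gt0.
have : `|v : 'rV_n|^-1 *: (v : 'rV_n) \in S.
  by rewrite inE /S/= normrZ normfV normr_id mulVf// gt_eqF.
by move=> /minv; rewrite tnormZ normfV normr_id mulrC ler_pdivlMr.
Qed.

End metric_theory.

(** * The tangent flow over an invariant set *)

Section cocycle.
Variables (R : realType) (n : nat) (M : manifold R n) (g : metric M).
Hypothesis Mc : compact [set: M].
Implicit Types (x y : M) (X : flow M) (L : set M) (E F : subspaces M).

(** Differentiate [X t (X s x) = X s (X t x)] with respect to [s] at [0]. *)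
Lemma tmap_field X t x : differentiable_at (X t) x ->
  tmap (X t) x (field X x) = field X (X t x).
Proof.
move=> dX; apply: etrans (tmapE _ _ _) _.
set i := chart_at x; set y := X t x; set j := chart_at y.
have dx : dom i x := dom_chart_at x; have dy : dom j y := dom_chart_at y.
have vel z : is_derive 0 (1 : R) (fun s => chart (chart_at z) (X s z)) (field X z).
  have [_ D] := integral_curve_flow X z.
  have := D 0 (chart_at z); rewrite flow0// => /(_ (dom_chart_at z)).
  by rewrite local_fieldE ?tcoord_chart_at//; exact: dom_chart_at.
have dX' : differentiable (chart_map (X t) x) ((fun s => chart i (X s x)) 0).
  by rewrite /= flow0.
have [_ D1] := is_derive_diff_comp (vel x) dX'.
have [_ D2] := vel y.
rewrite /= flow0 in D1; rewrite -[LHS]D1 -[RHS]D2.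
apply: near_eq_derive; near=> s.
have ds : dom i (X s x).
  near: s; have [_ cX _] := trajectoryP X.
  by apply: (cX x 0); rewrite flow0; exact: near_dom.
by rewrite /chart_map/= chartK// -!flowD// addrC.
Unshelve. all: by end_near. Qed.

Lemma field_bounded X : exists2 B, 0 <= B & forall x, tnorm g x (field X x) <= B.
Proof.
pose P (B : R) x := 0 <= B /\ tnorm g x (field X x) <= B.
have cover x : [set: M] x -> \forall y \near x & B \near +oo, P B y.
  move=> _; have [C C0 nC] := tnorm_near g x; set i := chart_at x in nC.
  have dx : dom i x := dom_chart_at x.
  have ix : (chart i @` dom i) (chart i x) by exists x.
  have cY : {for chart i x, continuous (local_field X i)}.
    by apply: differentiable_continuous; case: (@field_C1 _ _ _ X i) => + _; exact.
  have := cvgr_norm_lt _ cY (`|local_field X i (chart i x)| + 1).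
  rewrite ltrDl ltr01 => /(_ (nbhs_filter _) isT) nY.
  set B := `|_| + 1 in nY.
  have nY' := near_chart (P := [set z | `|local_field X i z| < B]) dx nY.
  exists ([set y | tnorm g y (field X y) <= C * B], [set b | C * B <= b]).
    split => /=; last by apply: nbhs_pinfty_ge; exact: num_real.
    near=> y; have [dy lY] : dom i y /\ `|local_field X i (chart i y)| < B.
      by near: y; exact: nY'.
    have [_ le] : dom i y /\ forall v : tangent y, tnorm g y v <= C * `|tcoord i y v|.
      by near: y; exact: nC.
    by apply: le_trans (le _) _; rewrite ler_wpM2l ?(ltW C0)// -local_fieldE// ltW.
  move=> [y b] /= [yB Bb]; split; last exact: le_trans yB Bb.
  by rewrite (le_trans _ Bb)// mulr_ge0 ?(ltW C0)// addr_ge0.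
have := (compact_near_coveringP _).1 Mc _ _ P _ cover.
have FF : ProperFilter (+oo : set_system R) by exact: proper_pinfty_nbhs.
move=> /(_ _)/filter_ex[B BP]; exists `|B| => // x.
by have [_ /le_trans] := BP x I; apply; exact: ler_norm.
Unshelve. all: by end_near. Qed.

(** The two properties of a set under which the tangent maps of the flow form a
    cocycle over it. *)
Definition differentiable_along X L : Prop :=
  invariant_set X L /\ forall t x, L x -> differentiable_at (X t) x.

Lemma splitting_differentiable X L E F : invariant_set X L ->
  invariant_bundle X L E -> invariant_bundle X L F ->
  (forall x, L x -> (E x + F x)%VS = fullv) -> differentiable_along X L.
Proof.
move=> iL iE iF full; split=> // t x Lx; apply: onto_differentiable.
have Ly : L (X t x) by rewrite -(iL t); exists x.
by rewrite -[in LHS](full x Lx) limgD iE// iF// full.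
Qed.

Lemma differentiable_along_of_reverse X L :
  differentiable_along (reverse X) L -> differentiable_along X L.
Proof.
move=> [iL dL]; split=> t; first by rewrite -[in RHS](iL (- t))/= opprK.
by move=> x Lx; have := dL (- t) x Lx; rewrite /= opprK.
Qed.

Lemma invariant_bundle_reverse X L E :
  invariant_bundle (reverse X) L E -> invariant_bundle X L E.
Proof. by move=> iE t x Lx; have := iE (- t) x Lx; rewrite /= opprK. Qed.

Section along.
Variables (X : flow M) (L : set M).
Hypothesis XL : differentiable_along X L.

Lemma along_flow t x : L x -> L (X t x).
Proof. by move=> Lx; rewrite -(XL.1 t); exists x. Qed.

Lemma tmapD s t x v : L x ->
  tmap (X (s + t)) x v = tmap (X s) (X t x) (tmap (X t) x v).
Proof.
move=> Lx; have -> : X (s + t) = X s \o X t by apply/funext => z; exact: flowD.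
apply: tmap_comp; [exact: flow_continuous|exact: XL.2|].
exact/XL.2/along_flow.
Qed.

Lemma tmap0 x v : tmap (X 0) x v = v.
Proof.
have -> : trajectory X 0 = id by apply/funext => z; exact: flow0.
exact: tmap_id.
Qed.

Lemma tmapNK t x v : L x -> tmap (X (- t)) (X t x) (tmap (X t) x v) = v.
Proof. by move=> Lx; apply: etrans (esym (tmapD _ _ _ Lx)) _; rewrite addNr tmap0. Qed.

Lemma tmapKN t x v : L x -> tmap (X t) (X (- t) x) (tmap (X (- t)) x v) = v.
Proof. by move=> Lx; apply: etrans (esym (tmapD _ _ _ Lx)) _; rewrite subrr tmap0. Qed.

Lemma differentiable_along_reverse : differentiable_along (reverse X) L.
Proof. by split=> t; [exact: XL.1|exact: XL.2]. Qed.

Lemma invariant_bundle_mem E t x v : invariant_bundle X L E -> L x ->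
  v \in E x -> tmap (X t) x v \in E (X t x).
Proof. by move=> iE Lx vE; rewrite -(iE t x Lx) memv_img. Qed.

Lemma tnormKN t x v : L x ->
  tnorm g (X t (X (- t) x)) (tmap (X t) (X (- t) x) (tmap (X (- t)) x v)) = tnorm g x v.
Proof.
move=> Lx; exact: (congr2 (fun z (w : 'rV[R]_n) => tnorm g z w) (flowKN Mc X t x)
  (tmapKN t v Lx)).
Qed.

Lemma contracting_past E K lam t x v : invariant_bundle X L E ->
  contracting g X L E K lam -> L x -> v \in E x -> 0 <= t ->
  tnorm g x v <= K * expR (- lam * t) * tnorm g (X (- t) x) (tmap (X (- t)) x v).
Proof.
move=> iE cE Lx vE t0.
have := cE _ _ _ (along_flow (- t) Lx) (invariant_bundle_mem (- t) iE Lx vE) t0.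
by apply: le_trans; exact: le_of_eq (esym (tnormKN _ _ Lx)).
Qed.

(** Contraction in the future means exponential growth in the past, which no
    bounded backward orbit allows. The lemma is used for components of the field
    and of vectors contracted by the reversed flow. *)
Lemma contracting_bounded_past E K lam x v B : invariant_bundle X L E -> 0 < lam ->
  contracting g X L E K lam -> L x -> v \in E x ->
  (forall t, 0 <= t -> tnorm g (X (- t) x) (tmap (X (- t)) x v) <= B) ->
  v = 0.
Proof.
move=> iE lam0 cE Lx vE le_B; apply/eqP; apply: contrapT => /negP v0.
have nv := tnorm_gt0 g (v0 : (v : 'rV_n) != 0).
have [T T0 small] := expR_small (`|K| * B) lam0 (divr_gt0 (nv x) (ltr0Sn _ 1)).
have le1 := contracting_past iE cE Lx vE T0.
have : tnorm g x v <= `|K| * B * expR (- lam * T).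
  apply: le_trans le1 _; rewrite mulrAC ler_wpM2r ?expR_ge0//.
  apply: (@le_trans _ _ (`|K| * tnorm g (X (- T) x) (tmap (X (- T)) x v))).
    by rewrite ler_wpM2r ?tnorm_ge0// ler_norm.
  by rewrite ler_wpM2l// le_B.
move=> /le_trans/(_ (small T (lexx _))); have := nv x; lra.
Qed.

Lemma contracting_orbit_bounded E K lam x v t : 0 < lam ->
  contracting g X L E K lam -> L x -> v \in E x -> 0 <= t ->
  tnorm g (X t x) (tmap (X t) x v) <= `|K| * tnorm g x v.
Proof.
move=> lam0 cE Lx vE t0; apply: le_trans (cE x v t Lx vE t0) _.
rewrite ler_wpM2r ?tnorm_ge0// (le_trans (ler_wpM2r (expR_ge0 _) (ler_norm K)))//.
by rewrite ler_piMr// -expR0 ler_expR mulNr oppr_le0 mulr_ge0// ltW.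
Qed.

(** Write [v = e + f]. If [e] were not zero, then in the past its image would grow
    exponentially and, by domination, be at least twice as long as the image of
    [f], so that the image of [v] would grow as well. *)
Lemma dominated_bounded_past E F K lam x (v : 'rV[R]_n) B :
  dominated_splitting g X L E F -> 0 < lam -> contracting g X L E K lam -> L x ->
  (forall t, 0 <= t -> tnorm g (X (- t) x) (tmap (X (- t)) x v) <= B) ->
  v \in F x.
Proof.
move=> [_ [iE iF] sp [K' [lam' [K'0 lam'0 dom]]]] lam0 cE Lx le_B.
have : v \in (E x + F x)%VS by rewrite (sp x Lx).1 memvf.
move=> /memv_addP[e eE [f fF vef]].
suff -> : v = f by [].
rewrite vef -[RHS]add0r; congr (_ + _).
apply/eqP; apply: contrapT => /negP e0.
have ne : 0 < tnorm g x e := tnorm_gt0 g (e0 : (e : 'rV_n) != 0).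
have half : 0 < 2^-1 :> R by rewrite invr_gt0.
have [T T0 small] := expR_small (K' * (tnorm g x f / tnorm g x e)) lam'0 half.
have [T' T'0 small'] := expR_small (`|K| * (2 * B)) lam0 (divr_gt0 ne (ltr0Sn _ 1)).
pose t := Num.max T T'; have t0 : 0 <= t by rewrite le_max T0.
have Ly := along_flow (- t) Lx.
have eE' := invariant_bundle_mem (- t) iE Lx eE.
have fF' := invariant_bundle_mem (- t) iF Lx fF.
have dom1 := dom _ t _ _ Ly t0 eE' fF'.
have cE1 := contracting_past iE cE Lx eE t0.
have le_e : tnorm g x e <= tnorm g (X t (X (- t) x))
    (tmap (X t) (X (- t) x) (tmap (X (- t)) x e)) :=
  le_of_eq (esym (tnormKN _ _ Lx)).
have le_f : tnorm g (X t (X (- t) x))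
    (tmap (X t) (X (- t) x) (tmap (X (- t)) x f)) <= tnorm g x f :=
  le_of_eq (tnormKN _ _ Lx).
have dom2 : tnorm g x e * tnorm g (X (- t) x) (tmap (X (- t)) x f) <=
    K' * expR (- lam' * t) * tnorm g x f * tnorm g (X (- t) x) (tmap (X (- t)) x e).
  apply: le_trans (ler_wpM2r (tnorm_ge0 _ _) le_e) _; apply: le_trans dom1 _.
  have c0 : 0 <= K' * expR (- lam' * t) by rewrite mulr_ge0 ?expR_ge0// ltW.
  exact: (ler_wpM2r (tnorm_ge0 _ _) (ler_wpM2l c0 le_f)).
clear dom1 le_e le_f eE' fF' Ly.
have leB := le_B t t0.
have vef' : tmap (X (- t)) x v = tmap (X (- t)) x e + tmap (X (- t)) x f.
  by rewrite vef; exact: linearD.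
move: dom2 cE1 leB vef'; move: (tmap _ x v) (tmap _ x e) (tmap _ x f) => v' e' f'.
move: (X (- t) x) => y dom2 cE1 + Ev; rewrite {v'}Ev => leB.
have le1 : tnorm g y e' <= B + tnorm g y f'.
  rewrite -[X in tnorm g y X](addrK (f' : 'rV_n)) (le_trans (tnormD _ _ _))//.
  by rewrite tnormN lerD2r.
have le2 : tnorm g y f' <= 2^-1 * tnorm g y e'.
  have := small t; rewrite le_max lexx => /(_ isT) s1.
  apply: le_trans (ler_wpM2r (tnorm_ge0 _ _) s1).
  rewrite -(ler_pM2l ne) (le_trans dom2)// le_eqVlt; apply/orP; left; apply/eqP.
  by field; rewrite gt_eqF.
have le3 : tnorm g y e' <= 2 * B by lra.
have : tnorm g x e <= `|K| * (2 * B) * expR (- lam * t).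
  apply: le_trans cE1 _; rewrite mulrAC ler_wpM2r ?expR_ge0//.
  by rewrite (le_trans (ler_wpM2r (tnorm_ge0 _ _) (ler_norm K)))// ler_wpM2l.
have := small' t; rewrite le_max lexx orbT => /(_ isT) s2 /le_trans/(_ s2); lra.
Qed.

End along.
End cocycle.

(** * The flow near a singularity *)

Section singularity.
Variables (R : realType) (n : nat) (M : manifold R n).
Hypothesis Mc : compact [set: M].
Variables (X : flow M) (sigma : M).
Hypothesis sing : Sing X sigma.
Let i := chart_at sigma.
Let z0 : 'rV[R]_n := chart i sigma.
Let Y := local_field X i.
Let A : {linear 'rV[R]_n -> 'rV[R]_n} := 'd Y z0.

Let ds : dom i sigma. Proof. exact: dom_chart_at. Qed.

Let Yz0 : Y z0 = 0.
Proof. by rewrite /Y local_fieldE// tcoord_chart_at. Qed.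

Lemma flow_fixed t : X t sigma = sigma.
Proof.
have ic : integral_curve X (cst sigma).
  split=> [s|s j dj]; first exact: cst_continuous.
  rewrite local_fieldE// sing /tcoord linear0.
  exact: (is_derive_cst (chart j sigma)).
have := integral_curve_unique Mc ic (integral_curve_flow X sigma).
by rewrite flow0 => /(_ erefl)/(congr1 (@^~ t)).
Qed.

Lemma chart_curve y t : dom i (X t y) ->
  is_derive t (1 : R) (fun s => chart i (X s y)) (Y (chart i (X t y))).
Proof. by move=> dt; have [_] := integral_curve_flow X y; exact. Qed.

(** Gronwall's inequality for the distance to the singularity, at which the field
    vanishes. *)
Lemma stay_near T rho : 0 <= T -> 0 < rho ->
  exists2 r, 0 < r & forall y, dom i y -> `|chart i y - z0| <= r ->
    forall t, 0 <= t <= T -> dom i (X t y) /\ `|chart i (X t y) - z0| < rho.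
Proof.
move=> T0 rho0; have [rhoL [L [rhoL0 L0 lip]]] := local_field_lipschitz X ds.
pose rho1 := Num.min rho rhoL.
have rho10 : 0 < rho1 by rewrite lt_min rho0.
have z0r : `|z0 - z0| <= rhoL by rewrite subrr normr0 ltW.
pose G := expR ((L + 1) * T).
have G0 : 0 < G by exact: expR_gt0.
have G1 : 1 <= G by rewrite /G -expR0 ler_expR mulr_ge0// addr_ge0.
have r0 : 0 < rho1 / (2 * G) by rewrite divr_gt0// mulr_gt0.
have rG : rho1 / (2 * G) * G < rho1.
  have -> : rho1 / (2 * G) * G = rho1 / 2 by field; rewrite gt_eqF.
  lra.
exists (rho1 / (2 * G)) => // y dy yr t tT.
have to_rhoL z : `|z - z0| <= rho1 -> `|z - z0| <= rhoL.
  by move=> /le_trans; apply; rewrite ge_min lexx orbT.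
suff [dt lt] : dom i (X t y) /\ `|chart i (X t y) - z0| < rho1.
  by split=> //; rewrite (lt_le_trans lt)// ge_min lexx.
apply: (trapping (t := T) (c := X ^~ y)) tT.
- by move=> z /to_rhoL zr; case: (lip z z0 zr z0r).
- by have [] := integral_curve_flow X y.
- by rewrite flow0.
- rewrite flow0; apply: le_lt_trans yr _; apply: le_lt_trans rG.
  by rewrite ler_peMr// ltW.
move=> s /andP[s0 sT] IH.
have Du r : 0 <= r <= s -> is_derive r (1 : R)
    (fun r => chart i (X r y) - z0) (Y (chart i (X r y))).
  move=> rs; have [dr _] := IH r rs.
  by apply: is_derive_eq (is_deriveB (chart_curve dr) (is_derive_cst _ _ _)) _; rewrite subr0.
have := gronwall L0 (lexx 0) s0 Du; rewrite flow0 addr0 => gr.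
apply: le_lt_trans (gr _) _.
  move=> r rs; rewrite addr0 -[Y _]subr0 -Yz0.
  by have [_ cr] := IH r rs; case: (lip _ _ (to_rhoL _ cr) z0r).
apply: le_lt_trans rG; apply: ler_pM => //; rewrite ler_expR ler_wpM2l//.
by rewrite addr_ge0.
Qed.

(** Near the singularity, the difference of two orbits obeys the linearized
    equation up to a relative error [eps]; here this only serves to bound its
    growth by a factor that depends on [T] but not on [eps]. *)
Lemma orbit_separation eps rho CA T y y' : 0 <= CA -> 0 <= eps <= 1 -> 0 <= T ->
  (forall v, `|A v| <= CA * `|v|) ->
  (forall z z', `|z - z0| <= rho -> `|z' - z0| <= rho ->
     `|Y z - Y z' - A (z - z')| <= eps * `|z - z'|) ->
  (forall t, 0 <= t <= T -> dom i (X t y) /\ `|chart i (X t y) - z0| <= rho) ->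
  (forall t, 0 <= t <= T -> dom i (X t y') /\ `|chart i (X t y') - z0| <= rho) ->
  forall t, 0 <= t <= T ->
  `|chart i (X t y) - chart i (X t y')| <=
    `|chart i y - chart i y'| * expR ((CA + 1 + 1) * T).
Proof.
move=> CA0 /andP[eps0 eps1] T0 leA sd stay stay' t /andP[t0 tT].
have sub s : 0 <= s <= t -> 0 <= s <= T by move=> /andP[-> st]; rewrite (le_trans st).
have Du s : 0 <= s <= t -> is_derive s (1 : R)
    (fun s => chart i (X s y) - chart i (X s y'))
    (Y (chart i (X s y)) - Y (chart i (X s y'))).
  move=> /sub st; have [d1 _] := stay s st; have [d2 _] := stay' s st.
  exact: is_deriveB (chart_curve d1) (chart_curve d2).
have CA1 : 0 <= CA + 1 by rewrite addr_ge0.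
have := gronwall CA1 (lexx 0) t0 Du; rewrite !flow0 addr0 => gr.
apply: le_trans (gr _) _; last first.
  by rewrite ler_wpM2l// ler_expR ler_wpM2l// addr_ge0.
move=> s /sub st; have [_ c1] := stay s st; have [_ c2] := stay' s st.
set w := chart i (X s y) - chart i (X s y').
have le1 := sd _ _ c1 c2; rewrite -/w in le1.
rewrite addr0 -[Y _ - _](subrK (A w)) (le_trans (ler_normD _ _))//.
rewrite mulrDl addrC lerD// (le_trans le1)// ler_wpM2r//.
Qed.

Lemma tmap_near T : differentiable_at (X T) sigma -> forall eps, 0 < eps ->
  \forall z \near z0,
    `|chart i (X T (chartV i z)) - z0 - tmap (X T) sigma (z - z0)| <= eps * `|z - z0|.
Proof.
move=> dX eps eps0; have nE := diff_eps dX eps0.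
have E z : chart_map (X T) sigma z = chart i (X T (chartV i z)).
  by rewrite /chart_map/= flow_fixed.
near=> z.
have : `|chart_map (X T) sigma z - chart_map (X T) sigma z0 -
   'd (chart_map (X T) sigma) z0 (z - z0)| <= eps * `|z - z0| by near: z; exact: nE.
rewrite !E {2}/z0 chartK// flow_fixed; congr (`|_ - _| <= _).
exact: (esym (tmapE (X T) sigma (z - z0))).
Unshelve. all: by end_near. Qed.

(** Strict differentiability of the time-[T] map at the singularity is deduced
    from differentiability there. Let [y''] be the point at the same displacement
    [h] from the singularity as [y] from [y']. Both differences of orbits satisfy
    the linearized equation up to a small relative error and start at [h], hence
    agree at time [T] up to a small relative error, and differentiability applies
    to the orbit of [y'']. *)
Lemma flow_strict_diff T eps : 0 <= T -> 0 < eps -> differentiable_at (X T) sigma ->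
  exists2 r, 0 < r & forall y y', dom i y -> dom i y' ->
    `|chart i y - z0| <= r -> `|chart i y' - z0| <= r ->
    [/\ dom i (X T y), dom i (X T y') &
    `|chart i (X T y) - chart i (X T y') - tmap (X T) sigma (chart i y - chart i y')|
      <= eps * `|chart i y - chart i y'|].
Proof.
move=> T0 eps0 dX; have [CA /ltW CA0 leA] := linear_bounded A.
pose G := expR ((CA + 1 + 1) * T); have G0 : 0 < G := expR_gt0 _.
(* Gronwall's inequality will bound the discrepancy at time [T] of the two
   differences of orbits by [2 * eps1 * G * G] times their initial length. *)
pose eps1 := Num.min 1 (eps / (4 * (G * G))).
have eps10 : 0 < eps1 by rewrite lt_min ltr01 divr_gt0// !mulr_gt0.
have eps11 : 0 <= eps1 <= 1 by rewrite ltW//= ge_min lexx.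
have [rho1 rho10 sd] := local_field_strict_diff X ds eps10.
have {}sd z z' : `|z - z0| <= rho1 -> `|z' - z0| <= rho1 ->
    (chart i @` dom i) z /\ `|Y z - Y z' - A (z - z')| <= eps1 * `|z - z'|.
  exact: sd.
have sd2 z z' zr z'r := (sd z z' zr z'r).2.
have [r2 r20 stay] := stay_near T0 rho10.
have half0 : 0 < eps / 2 by rewrite divr_gt0.
have /nbhs_ballP[r3 /= r30 r3P] := tmap_near dX half0.
pose r := Num.min (r2 / 2) (Num.min (r3 / 4) (rho1 / 2)).
have r0 : 0 < r by rewrite !lt_min !divr_gt0.
exists r => // y y' dy dy' yr y'r.
have rr2 : r <= r2 / 2 by rewrite ge_min lexx.
have rr3 : r <= r3 / 4 by rewrite !ge_min lexx orbT.
have rrho : r <= rho1 / 2 by rewrite !ge_min lexx !orbT.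
set h := chart i y - chart i y'.
have hr : `|h| <= 2 * r.
  have -> : h = (chart i y - z0) - (chart i y' - z0) by rewrite /h opprB addrA subrK.
  by rewrite (le_trans (ler_normB _ _))//; lra.
have zh : `|z0 + h - z0| <= rho1 by rewrite addrC addKr; lra.
have zz : `|z0 - z0| <= rho1 by rewrite subrr normr0 ltW.
have [d'' c''] := chartV_dom (sd _ _ zh zz).1.
set y'' := chartV i (z0 + h) in d'' c''.
have le_stay z : dom i z -> `|chart i z - z0| <= r2 -> forall t, 0 <= t <= T ->
    dom i (X t z) /\ `|chart i (X t z) - z0| <= rho1.
  by move=> dz zr t tT; have [? /ltW] := stay z dz zr t tT.
have sty : forall t, 0 <= t <= T -> dom i (X t y) /\ `|chart i (X t y) - z0| <= rho1.
  by apply: le_stay => //; lra.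
have sty' : forall t, 0 <= t <= T -> dom i (X t y') /\ `|chart i (X t y') - z0| <= rho1.
  by apply: le_stay => //; lra.
have sty'' : forall t, 0 <= t <= T -> dom i (X t y'') /\ `|chart i (X t y'') - z0| <= rho1.
  by apply: le_stay => //; rewrite c'' addrC addKr; lra.
have stys t : 0 <= t <= T -> dom i (X t sigma) /\ `|chart i (X t sigma) - z0| <= rho1.
  by rewrite flow_fixed.
have TT : 0 <= T <= T by rewrite T0 lexx.
have [dTy _] := sty T TT; have [dTy' _] := sty' T TT.
split=> //.
have gp t : 0 <= t <= T -> `|chart i (X t y) - chart i (X t y')| <= `|h| * G.
  exact: (orbit_separation CA0 eps11 T0 leA sd2 sty sty').
have gr t : 0 <= t <= T -> `|chart i (X t y'') - z0| <= `|h| * G.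
  move=> tT; have := orbit_separation CA0 eps11 T0 leA sd2 sty'' stys tT.
  by rewrite flow_fixed -/z0 c'' [z0 + h - z0]addrC addKr.
pose c := 2 * eps1 * (`|h| * G).
have c0 : 0 <= c by rewrite mulr_ge0 ?mulr_ge0// ltW.
pose u t := (chart i (X t y) - chart i (X t y')) - (chart i (X t y'') - z0).
have Du t : 0 <= t <= T -> is_derive t (1 : R) u
    ((Y (chart i (X t y)) - Y (chart i (X t y'))) - (Y (chart i (X t y'')) - 0)).
  move=> tT; have [d1 _] := sty t tT; have [d2 _] := sty' t tT; have [d3 _] := sty'' t tT.
  apply: is_deriveB; apply: is_deriveB; exact: chart_curve.
have := gronwall CA0 c0 T0 Du => gu.
have u0 : u 0 = 0.
  by rewrite /u !flow0 c'' [z0 + h - z0]addrC addKr subrr.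
have uT : `|u T| <= eps / 2 * `|h|.
  apply: le_trans (gu _) _.
    move=> t tT; have [_ c1] := sty t tT; have [_ c2] := sty' t tT; have [_ c3] := sty'' t tT.
    have e1 := sd2 _ _ c1 c2; have e2 := sd2 _ _ c3 zz; rewrite Yz0 in e2.
    have g1 := gp t tT; have g2 := gr t tT; have lu := leA (u t).
    move: e1 e2 lu; rewrite [A (u t)]linearB -/(u t).
    set p := chart i (X t y) - _; set q := chart i (X t y'') - z0.
    set P := Y _ - Y _; set Q := Y _ - 0 => e1 e2 lu.
    have -> : P - Q = (P - A p) - (Q - A q) + (A p - A q).
      by move: (A p) (A q) => a b; apply/rowP => k; rewrite !mxE; ring.
    have le1 : `|P - A p| <= eps1 * (`|h| * G).
      by apply: le_trans e1 _; rewrite ler_wpM2l ?(ltW eps10).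
    have le2 : `|Q - A q| <= eps1 * (`|h| * G).
      by apply: le_trans e2 _; rewrite ler_wpM2l ?(ltW eps10).
    apply: le_trans (ler_normD _ _) _; rewrite addrC lerD//.
    apply: le_trans (ler_normB _ _) _; rewrite /c; lra.
  rewrite u0 normr0 add0r.
  have le_exp : expR ((CA + 1) * T) <= G by rewrite ler_expR ler_wpM2r// lerDl.
  apply: le_trans (ler_wpM2l c0 le_exp) _; rewrite /c.
  have le_e : eps1 <= eps / (4 * (G * G)) by rewrite ge_min lexx orbT.
  have -> : eps / 2 * `|h| = 2 * (eps / (4 * (G * G))) * (`|h| * G) * G.
    by field; rewrite gt_eqF.
  have hG : 0 <= `|h| * G by rewrite mulr_ge0// ltW.
  by rewrite (ler_wpM2r (ltW G0))// (ler_wpM2r hG)// ler_wpM2l.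
have rT : `|chart i (X T y'') - z0 - tmap (X T) sigma h| <= eps / 2 * `|h|.
  have := r3P (z0 + h); rewrite -ball_normE/= opprD addrA subrr sub0r normrN.
  have -> : z0 + h - z0 = h by rewrite addrC addKr.
  by apply; lra.
set Bh := tmap _ _ _ in rT *.
have -> : chart i (X T y) - chart i (X T y') - Bh = u T + (chart i (X T y'') - z0 - Bh).
  by rewrite /u addrA subrK.
by apply: le_trans (ler_normD _ _) _; lra.
Qed.

(** The displacement [u] from the initial point satisfies
    [|u'| <= L * |u| + |Y (chart i y)|], to which Gronwall's inequality applies. It
    will give a lower bound of the velocity near a hyperbolic singularity. *)
Lemma displacement T : 0 <= T -> exists2 C, 0 < C & exists2 r, 0 < r &
  forall y, dom i y -> `|chart i y - z0| <= r ->
    dom i (X T y) /\ `|chart i (X T y) - chart i y| <= C * `|Y (chart i y)|.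
Proof.
move=> T0; have [rho [L [rho0 L0 lip]]] := local_field_lipschitz X ds.
have [r r0 stay] := stay_near T0 rho0.
exists (expR ((L + 1) * T)); first exact: expR_gt0.
exists r => // y dy yr; have sty := stay y dy yr.
have [|dT _] := sty T; first by rewrite T0 lexx.
split=> //.
have zr t : 0 <= t <= T -> `|chart i (X t y) - z0| <= rho by move=> /sty[_ /ltW].
have yr' : `|chart i y - z0| <= rho by have := zr 0; rewrite flow0 lexx T0; exact.
have Du t : 0 <= t <= T -> is_derive t (1 : R)
    (fun t => chart i (X t y) - chart i y) (Y (chart i (X t y))).
  move=> tT; have [d _] := sty t tT.
  by apply: is_derive_eq (is_deriveB (chart_curve d) (is_derive_cst _ _ _)) _; rewrite subr0.
have := gronwall L0 (normr_ge0 (Y (chart i y))) T0 Du.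
rewrite flow0 subrr normr0 add0r => gr; rewrite mulrC; apply: gr => t tT.
rewrite -{1}[Y (chart i (X t y))](subrK (Y (chart i y))).
apply: le_trans (ler_normD _ _) _; rewrite lerD2r.
by have [_] := lip _ _ (zr t tT) yr'.
Qed.

(** Apply strict differentiability to [y] and [X s y], divide by [s] and let [s]
    tend to [0]. *)
Lemma velocity_transport T eps : 0 <= T -> 0 < eps -> differentiable_at (X T) sigma ->
  exists2 r, 0 < r & forall y, dom i y -> `|chart i y - z0| < r ->
    dom i (X T y) /\
    `|Y (chart i (X T y)) - tmap (X T) sigma (Y (chart i y))| <= eps * `|Y (chart i y)|.
Proof.
move=> T0 eps0 dX; have [r r0 sd] := flow_strict_diff T0 eps0 dX.
exists r => // y dy yr.
have [dT _ _] := sd y y dy dy (ltW yr) (ltW yr); split=> //.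
pose B : {linear 'rV[R]_n -> 'rV[R]_n} := tmap (X T) sigma.
have cB : continuous B by exact: linear_rV_continuous.
have Dp : is_derive 0 (1 : R) (fun s => chart i (X s y)) (Y (chart i y)).
  by have := @chart_curve y 0; rewrite flow0; exact.
have Dq : is_derive 0 (1 : R) (fun s => chart i (X s (X T y))) (Y (chart i (X T y))).
  by have := @chart_curve (X T y) 0; rewrite flow0; exact.
have DB : is_derive 0 (1 : R) (B \o (fun s => chart i (X s y))) (B (Y (chart i y))).
  have dB : differentiable B (chart i (X 0 y)) := linear_differentiable _ cB.
  apply: is_derive_eq (is_derive_diff_comp Dp dB) _.
  exact: (congr1 (@^~ _) (diff_lin _ cB)).
apply: derive_dominated (is_deriveB Dq DB) Dp _.
have nV : \forall x \near y, dom i x /\ `|chart i x - z0| < r.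
  apply: (near_chart (P := [set z | `|z - z0| < r]) dy).
  exact: (cvgr_lt _ (@continuous_dist R n z0 (chart i y)) _ yr).
have cy : X s y @[s --> (0 : R)] --> y.
  by have [+ _] := integral_curve_flow X y => /(_ 0); rewrite /continuous_at flow0.
have nV' : \forall s \near (0 : R), dom i (X s y) /\ `|chart i (X s y) - z0| < r.
  exact: cy _ nV.
near=> s; have [dsy sr] : dom i (X s y) /\ `|chart i (X s y) - z0| < r.
  by near: s; exact: nV'.
have [_ _] := sd _ _ dsy dy (ltW sr) (ltW yr).
have -> : X T (X s y) = X s (X T y) by rewrite -!flowD// addrC.
rewrite /= !flow0; congr (_ <= _); congr (`| _ |).
rewrite [tmap _ _ _](linearB B) !fctE /= -/B.
rewrite !flow0; move: (tmap _ _ (chart i (X s y))) (tmap _ _ (chart i y)) => a b.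
by apply/rowP => k; rewrite !mxE; ring.
Unshelve. all: by end_near. Qed.

End singularity.

(** * Time reversal, the center bundle and its frames *)

Section reversal.
Variables (R : realType) (n : nat) (M : manifold R n) (g : metric M).
Hypothesis Mc : compact [set: M].
Variables (X : flow M) (L : set M).
Hypothesis XL : differentiable_along X L.
Implicit Types E F : subspaces M.

Lemma tnormNK t x v : L x ->
  tnorm g (X (- t) (X t x)) (tmap (X (- t)) (X t x) (tmap (X t) x v)) = tnorm g x v.
Proof.
move=> Lx; exact: (congr2 (fun z (w : 'rV[R]_n) => tnorm g z w) (flowNK Mc X t x)
  (tmapNK Mc XL t v Lx)).
Qed.

Lemma expanding_contracting E K lam : 0 < K -> invariant_bundle X L E ->
  expanding g X L E K lam -> contracting g (reverse X) L E K lam.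
Proof.
move=> K0 iE eE x v t Lx vE t0.
have := eE _ _ _ (along_flow XL (- t) Lx) (invariant_bundle_mem (- t) iE Lx vE) t0.
move=> /le_trans/(_ (le_of_eq (tnormKN g Mc XL t v Lx))) le1.
rewrite mulNr expRN -ler_pdivrMl; last by rewrite divr_gt0// expR_gt0.
by rewrite invf_div [_ / K]mulrC.
Qed.

Lemma contracting_expanding E K lam : 0 < K -> invariant_bundle X L E ->
  contracting g (reverse X) L E K lam -> expanding g X L E K lam.
Proof.
move=> K0 iE cE x v t Lx vE t0.
have := cE _ _ _ (along_flow XL t Lx) (invariant_bundle_mem t iE Lx vE) t0.
move=> /(le_trans (le_of_eq (esym (tnormNK t v Lx)))) le1.
have e0 : 0 < K^-1 * expR (lam * t) by rewrite mulr_gt0 ?invr_gt0// expR_gt0.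
rewrite -ler_pdivlMl//; apply: le_trans le1 _.
by rewrite invfM invrK mulNr expRN.
Qed.

End reversal.

Section field_direction.
Variables (R : realType) (n : nat) (M : manifold R n) (g : metric M).
Hypothesis Mc : compact [set: M].
Variables (X : flow M) (L : set M).
Hypothesis XL : differentiable_along X L.

Lemma field_orbit_bounded : exists B, forall x t, L x ->
  tnorm g (X t x) (tmap (X t) x (field X x)) <= B.
Proof.
have [B _ leB] := field_bounded g Mc X; exists B => x t Lx.
apply: le_trans (leB (X t x)); apply: le_of_eq.
exact: (congr1 (tnorm g (X t x)) (tmap_field Mc (XL.2 t x Lx))).
Qed.

(** The velocity is transported to velocities along the orbit, which are bounded
    on a compact manifold. *)
Lemma field_in_center E F K lam x : dominated_splitting g X L E F -> 0 < lam ->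
  contracting g X L E K lam -> L x -> field X x \in F x.
Proof.
move=> dEF lam0 cE Lx; have [B leB] := field_orbit_bounded.
by apply: (dominated_bounded_past Mc XL dEF lam0 cE Lx) => t _; exact: leB.
Qed.

End field_direction.

Lemma splitting_dim (R : realType) n (E F : {vspace 'rV[R]_n}) :
  (E + F)%VS = fullv -> directv (E + F) -> (\dim E + \dim F)%N = n.
Proof.
by move=> full; rewrite directvE/= => /eqP <-; rewrite full dimvf /dim/= mul1n.
Qed.

Section center_intersection.
Variables (R : realType) (n : nat) (M : manifold R n) (g : metric M).
Hypothesis Mc : compact [set: M].
Variables (X : flow M) (L L' : set M).
Hypotheses (XL : differentiable_along X L).

(** The area of a parallelogram spanned by two vectors of [F x :&: F' x] would be
    expanded from time [0] to [T], as they lie in [F], and expanded back from [T]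
    to [0], as their images lie in [F']. *)
Lemma center_cap_dim F F' K lam K' lam' x :
  invariant_bundle X L' F' ->
  0 < K -> 0 < lam -> sectionally_expanding g X L F K lam ->
  0 < K' -> 0 < lam' -> sectionally_expanding g (reverse X) L' F' K' lam' ->
  (forall t, L' (X t x)) -> L x -> (\dim (F x :&: F' x) <= 1)%N.
Proof.
move=> iF' K0 lam0 sF K'0 lam'0 sF' L'x Lx; rewrite leqNgt; apply/negP => dim2.
set P := (F x :&: F' x)%VS in dim2.
have L'x0 : L' x by have := L'x 0; rewrite flow0.
pose v := vpick P.
have vP : v \in P by exact: memv_pick.
have v0 : v != 0 by rewrite vpick0 -dimv_eq0 -lt0n (leq_trans _ dim2).
have [|u uP uv] := @subvPn _ _ P <[v]>%VS _.
  by apply: contraL dim2 => /dimvS; rewrite dim_vline v0 -leqNgt.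
have A0 : 0 < area g x u v.
  by apply: area_gt0 => // a; apply: contraNneq uv => ->; exact: memvZ (memv_line _).
move: uP vP; rewrite !memv_cap => /andP[uF uF'] /andP[vF vF'].
have [T T0 small] := expR_small (2 * (K * K')) lam0 ltr01.
have le1 := sF x u v T Lx uF vF T0.
have le2 := sF' _ _ _ T (L'x T) (invariant_bundle_mem T iF' L'x0 uF')
  (invariant_bundle_mem T iF' L'x0 vF') T0.
have E : area g (X (- T) (X T x)) (tmap (X (- T)) (X T x) (tmap (X T) x u))
    (tmap (X (- T)) (X T x) (tmap (X T) x v)) = area g x u v.
  have h z z' (a a' b b' : 'rV[R]_n) : z = z' -> a = a' -> b = b' ->
    area g z a b = area g z' a' b' by move=> -> -> ->.
  exact: h (flowNK Mc X T x) (tmapNK Mc XL T u Lx) (tmapNK Mc XL T v Lx).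
have {}le2 := le_trans le2 (le_of_eq E).
have c0 : 0 <= K'^-1 * expR (lam' * T) by rewrite mulr_ge0 ?expR_ge0// invr_ge0 ltW.
have {}le2 := le_trans (ler_wpM2l c0 le1) le2.
have ge1 : 1 <= expR (lam' * T) by rewrite -expR0 ler_expR mulr_ge0// ltW.
have := small T (lexx _); rewrite mulNr expRN => ge2.
have le3 : 2 <= K'^-1 * (K^-1 * expR (lam * T)).
  rewrite ler_pdivrMr ?expR_gt0// mul1r in ge2.
  by rewrite mulrA -invfM ler_pdivlMl ?mulr_gt0// mulrC [K' * K]mulrC.
have le4 : K'^-1 * (K^-1 * expR (lam * T)) <=
    K'^-1 * expR (lam' * T) * (K^-1 * expR (lam * T)).
  rewrite ler_wpM2r ?mulr_ge0 ?expR_ge0 ?invr_ge0 ?(ltW K0)//.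
  by rewrite ler_peMr ?invr_ge0 ?(ltW K'0).
have le5 := le_trans le3 le4.
rewrite mulrA in le2; have := le_trans (ler_wpM2r (ltW A0) le5) le2; lra.
Qed.

End center_intersection.

(** Expand [w] in the continuous frame of [F] and keep the coefficients while
    moving the frame to [x]. The coefficients are bounded by a multiple of [|f|]
    because the frame at [x] is free. *)
Lemma subbundle_near (R : realType) n (M : manifold R n) (L : set M)
    (F : subspaces M) x eps : subbundle L F -> L x -> 0 < eps ->
  \forall y \near x, L y -> forall w, w \in F y ->
    exists2 f, f \in F x & `|tcoord (chart_at x) y w - f| <= eps * `|f|.
Proof.
move=> sF Lx eps0; have [U [d [b [oU Ux Ud cb bF]]]] := sF x Lx.
set i := chart_at x in cb *; pose bx := [tuple b k x | k < d].
have [] := andP (bF x (conj Lx Ux)) => /eqP span_bx free_bx.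
have bE (k : 'I_d) : bx`_k = b k x by rewrite nth_mktuple.
(* a bound of the linear form that extracts the [k]-th coefficient *)
pose C k := xget 0 [set C : R | 0 < C /\ forall v, `|coord bx k v| <= C * `|v|].
have CP k : 0 < C k /\ forall v, `|coord bx k v| <= C k * `|v|.
  have [c c0 cP] := linear_bounded (coord bx k : {linear 'rV[R]_n -> R^o}).
  by apply: (@xgetPex _ 0 [set C : R | 0 < C /\ forall v, `|coord bx k v| <= C * `|v|]); exists c.
pose S := 1 + \sum_k C k.
have S0 : 0 < S by rewrite ltr_pwDl// sumr_ge0// => k _; rewrite ltW//; case: (CP k).
have eta0 : 0 < eps / S by rewrite divr_gt0.
have nb : \forall y \near x, (L `&` U) y -> forall k : 'I_d,
    `|tcoord i y (b k y) - b k x| <= eps / S.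
  have : \forall y \near x, forall k : 'I_d, (L `&` U) y ->
      `|tcoord i y (b k y) - b k x| <= eps / S.
    apply: (@filter_forall _ _ (fun k y => (L `&` U) y ->
      `|tcoord i y (b k y) - b k x| <= eps / S) (nbhs x)) => k.
    have /subspace_continuousP/(_ x (conj Lx Ux)) := cb k.
    rewrite /from_subspace/= [tcoord i x _]tcoord_chart_at.
    have Fw : Filter (within (L `&` U) (nbhs x)) by exact: within_filter.
    move=> /cvgrPdistC_le/(_ _ eta0).
    by rewrite near_withinE.
  by apply: filterS => y H LUy k; exact: H.
have nU : \forall y \near x, U y by exact: open_nbhs_nbhs.
near=> y => Ly w wF.
have Uy : U y by near: y; exact: nU.
have nbk : (L `&` U) y -> forall k : 'I_d, `|tcoord i y (b k y) - b k x| <= eps / S.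
  by near: y; exact: nb.
have {}nbk := nbk (conj Ly Uy).
have [] := andP (bF y (conj Ly Uy)) => /eqP span_by free_by.
set by_ := [tuple b k y | k < d] in span_by free_by.
have wE : w = \sum_(k < d) coord by_ k w *: b k y.
  rewrite {1}(coord_span (X := by_) (v := w)) ?span_by//.
  by apply: eq_bigr => k _; rewrite nth_mktuple.
pose a k := coord by_ k w.
pose f := \sum_(k < d) a k *: bx`_k.
have aE k : coord bx k f = a k by rewrite coord_sum_free.
exists f.
  by rewrite -span_bx; apply: memv_suml => k _; rewrite memvZ// memv_span// mem_nth// size_tuple.
have -> : tcoord i y w - f = \sum_(k < d) a k *: (tcoord i y (b k y) - b k x).
  rewrite wE /tcoord linear_sum /f -sumrB; apply: eq_bigr => k _.
  by rewrite linearZ bE scalerBr.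
apply: le_trans (ler_norm_sum _ _ _) _.
apply: (@le_trans _ _ (\sum_(k < d) C k * `|f| * (eps / S))).
  apply: ler_sum => k _; rewrite normrZ ler_pM//.
  by rewrite -aE; case: (CP k).
rewrite -mulr_suml -mulr_suml mulrAC ler_wpM2r// mulrA ler_pdivrMr// mulrC.
by rewrite ler_wpM2l ?(ltW eps0)// /S lerDr.
Unshelve. all: by end_near. Qed.

(** * Stable dimension at a singularity *)

Section singular_hyperbolic.
Variables (R : realType) (n : nat) (M : manifold R n) (g : metric M).
Hypothesis Mc : compact [set: M].
Variables (X : flow M) (sigma : M).
Hypothesis sing : Sing X sigma.
Hypothesis dX : forall t, differentiable_at (X t) sigma.
Variables Es Eu : subspaces M.
Hypothesis hyp : hyperbolic_splitting g X [set sigma] Es Eu.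

Lemma singleton_differentiable : differentiable_along X [set sigma].
Proof.
split=> t; last by move=> x ->; exact: dX.
by rewrite image_set1 flow_fixed.
Qed.

Lemma tnorm_fixed t (w : 'rV[R]_n) : tnorm g (X t sigma) w = tnorm g sigma w.
Proof. exact: (congr1 (fun z => tnorm g z w) (flow_fixed Mc sing t)). Qed.

Lemma fixed_mem (E : subspaces M) t v : invariant_bundle X [set sigma] E ->
  v \in E sigma -> tmap (X t) sigma v \in E sigma.
Proof.
move=> iE vE; have := invariant_bundle_mem t iE (erefl : [set sigma] sigma) vE.
by rewrite (flow_fixed Mc sing t).
Qed.

(** The two properties of the derivative at a hyperbolic singularity that matter
    below: expansion of the unstable space by a factor two in the sup norm of the
    coordinates, and absence of fixed vectors, from which the speed near the
    singularity is bounded below in terms of the distance to it. *)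
Lemma hyperbolic_time : exists2 T, 0 < T &
  (forall u, u \in Eu sigma -> 2 * `|u| <= `|tmap (X T) sigma u|) /\
  (forall h, tmap (X T) sigma h = h -> h = 0).
Proof.
have sm := singleton_differentiable.
have [_ [iEs _ iEu] sp [K [lam [K0 lam0 cE eE]]]] := hyp.
have [full dir] := sp sigma erefl.
have cEu := expanding_contracting Mc sm K0 iEu eE.
have [c c0 lec] := tnorm_ge g sigma; have [C C0 leC] := tnorm_le g sigma.
(* The contraction factor one half excludes fixed vectors; [c / (2 * C)] accounts
   for the passage from the Riemannian norm to the sup norm. *)
pose a := Num.min 2^-1 (c / (2 * C)).
have a0 : 0 < a by rewrite lt_min invr_gt0 ltr0n divr_gt0// mulr_gt0.
have [T0 T00 small] := expR_small K lam0 a0.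
pose T := T0 + 1; have Tpos : 0 < T by rewrite ltr_wpDl.
have T_ge : T0 <= T by rewrite lerDl.
pose kappa := K * expR (- lam * T).
have kappa0 : 0 <= kappa by rewrite mulr_ge0 ?expR_ge0// ltW.
have kappa_half : kappa <= 2^-1.
  by apply: le_trans (small T T_ge) _; rewrite ge_min lexx.
have kappa_c : kappa <= c / (2 * C).
  by apply: le_trans (small T T_ge) _; rewrite ge_min lexx orbT.
have con s : s \in Es sigma -> tnorm g sigma (tmap (X T) sigma s) <= kappa * tnorm g sigma s.
  move=> sE; have E := esym (tnorm_fixed T (tmap (X T) sigma s)).
  apply: le_trans (le_of_eq E) _; exact: cE sigma s T erefl sE (ltW Tpos).
have ex u : u \in Eu sigma -> tnorm g sigma u <= kappa * tnorm g sigma (tmap (X T) sigma u).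
  move=> uE; have := eE sigma u T erefl uE (ltW Tpos).
  move=> /le_trans/(_ (le_of_eq (tnorm_fixed T _))) le1.
  rewrite /kappa mulNr expRN -ler_pdivrMl; last by rewrite divr_gt0// expR_gt0.
  by rewrite invf_div [_ / K]mulrC.
exists T => //; split=> [u uE|h].
  have cu := lec u; have eu := ex u uE; have Cu := leC (tmap (X T) sigma u).
  move: cu eu Cu; move: (tmap (X T) sigma u) => w cu eu Cu.
  have le1 : c * `|u| <= c / (2 * C) * (C * `|w|).
    apply: le_trans cu _; apply: le_trans eu _; apply: ler_pM => //.
    exact: tnorm_ge0.
  have E : c / (2 * C) * (C * `|w|) = c * (2^-1 * `|w|) by field; rewrite gt_eqF.
  by move: le1; rewrite E ler_pM2l//; lra.
have : h \in (Es sigma + flow_direction X sigma + Eu sigma)%VS by rewrite full memvf.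
move=> /memv_addP[v /memv_addP[s sE [w wX ->]] [u uE ->]] fixh.
have w0 : w = 0.
  have : w \in <[field X sigma : 'rV_n]>%VS := wX.
  by rewrite sing => /vlineP[k ->]; rewrite scaler0.
move: fixh; rewrite w0 addr0 => fixh.
have Bs := fixed_mem T iEs sE; have Bu := fixed_mem T iEu uE.
have cs := con s sE; have eu := ex u uE.
have E : tmap (X T) sigma s + tmap (X T) sigma u = s + u.
  by rewrite -[RHS]fixh; exact: esym (linearD (tmap (X T) sigma) s u).
move: Bs Bu cs eu E; move: (tmap _ _ s) (tmap _ _ u) => s' u' Bs Bu cs eu E.
have dif : s' - s = u - u'.
  by apply/eqP; rewrite subr_eq addrAC eq_sym subr_eq addrC -E addrC.
have z0 : s' - s = 0.
  have : s' - s \in ((Es sigma + flow_direction X sigma) :&: Eu sigma)%VS.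
    rewrite memv_cap; apply/andP; split; last by rewrite dif rpredB.
    by apply: (subvP (addvSl _ _)); rewrite rpredB.
  move: dir; rewrite directv_addE => /and3P[_ _ /eqP ->].
  by rewrite memv0 => /eqP.
have ss : s' = s by apply/eqP; rewrite -subr_eq0 z0.
have uu : u' = u by apply/eqP; rewrite eq_sym -subr_eq0 -dif z0.
have zero (y : 'rV[R]_n) : tnorm g sigma y <= kappa * tnorm g sigma y -> y = 0.
  move=> le; apply/eqP; apply: contrapT => /negP/(tnorm_gt0 g (x := sigma)) y0.
  by have := ler_wpM2r (ltW y0) kappa_half; lra.
rewrite ss in cs; rewrite uu in eu.
by rewrite (zero s)// (zero u)// addr0.
Qed.

End singular_hyperbolic.

Section gap.
Variables (R : realType) (n : nat) (M : manifold R n) (g : metric M).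
Hypothesis Mc : compact [set: M].
Variables (X : flow M) (L : set M) (E F : subspaces M) (K lam : R) (sigma : M).
Hypothesis XL : differentiable_along X L.
Hypothesis domEF : dominated_splitting g X L E F.
Hypothesis lam0 : 0 < lam.
Hypothesis conE : contracting g X L E K lam.
Hypothesis Lsigma : L sigma.
Hypothesis sing : Sing X sigma.
Variables Es Eu : subspaces M.
Hypothesis hyp : hyperbolic_splitting g X [set sigma] Es Eu.

Let dX t : differentiable_at (X t) sigma := XL.2 t sigma Lsigma.
Let sm : differentiable_along X [set sigma] := singleton_differentiable Mc sing dX.

Lemma stable_unstable v : exists s u, [/\ s \in Es sigma, u \in Eu sigma & v = s + u].
Proof.
have [_ _ sp _] := hyp; have [full _] := sp sigma erefl.
have : v \in (Es sigma + flow_direction X sigma + Eu sigma)%VS by rewrite full memvf.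
move=> /memv_addP[w /memv_addP[s sE [x xX ->]] [u uE ->]]; exists s, u; split=> //.
have : x \in <[field X sigma : 'rV[R]_n]>%VS := xX.
by rewrite sing => /vlineP[k ->]; rewrite scaler0 addr0.
Qed.

(** The unstable component of a vector of [E sigma] has a bounded future, since
    the vector and its stable component are contracted; hence it vanishes. *)
Lemma subset_stable : (E sigma <= Es sigma)%VS.
Proof.
have [_ [iEs _ iEu] _ [K' [lam' [K'0 lam'0 cEs eEu]]]] := hyp.
apply/subvP => v vE; have [s [u [sE uE vsu]]] := stable_unstable v.
suff -> : v = s by [].
rewrite vsu; suff -> : u = 0 by rewrite addr0.
have cEu := expanding_contracting Mc sm K'0 iEu eEu.
have srev := differentiable_along_reverse sm.
have iEu' : invariant_bundle (reverse X) [set sigma] Eu by move=> t; exact: iEu.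
apply: (contracting_bounded_past Mc srev iEu' lam'0 cEu (x := sigma) erefl uE
  (B := `|K| * tnorm g sigma v + `|K'| * tnorm g sigma s)) => t t0.
have -> : reverse X (- t) = X t by rewrite /= opprK.
have us : u = v - s by rewrite vsu addrC addKr.
have Tus : tmap (X t) sigma u = tmap (X t) sigma v - tmap (X t) sigma s.
  by rewrite us; exact: linearB.
apply: le_trans (le_of_eq (congr1 (tnorm g _) Tus)) _.
apply: le_trans (tnormD _ _ _) _; rewrite tnormN lerD//.
  exact: (contracting_orbit_bounded lam0 conE Lsigma vE t0).
exact: (contracting_orbit_bounded lam'0 cEs erefl sE t0).
Qed.

(** Unstable vectors have a bounded past, hence lie in [F]. Therefore the stable
    component of a vector of [F sigma] lies in [F] as well, and also in [E]. *)
Lemma center_unstable : (Es sigma <= E sigma)%VS -> (F sigma <= Eu sigma)%VS.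
Proof.
move=> EsE; have [_ [iEs _ iEu] _ [K' [lam' [K'0 lam'0 cEs eEu]]]] := hyp.
apply/subvP => f fF; have [s [u [sE uE fsu]]] := stable_unstable f.
have cEu := expanding_contracting Mc sm K'0 iEu eEu.
have uF : u \in F sigma.
  apply: (dominated_bounded_past Mc XL domEF lam0 conE Lsigma (B := `|K'| * tnorm g sigma u)).
  by move=> t t0; exact: (contracting_orbit_bounded lam'0 cEu erefl uE t0).
have [_ _ spEF _] := domEF; have [_ /directv_addP cap0] := spEF sigma Lsigma.
have : s \in (E sigma :&: F sigma)%VS.
  rewrite memv_cap (subvP EsE)//=.
  have -> : s = f - u by rewrite fsu addrK.
  by rewrite rpredB.
by rewrite cap0 memv0 => /eqP s0; rewrite fsu s0 add0r.
Qed.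

(** Otherwise the center space [F sigma] would be expanded. Near the singularity,
    the velocity of the points of [L] lies in [F], so that steps of length [T]
    along an orbit would not decrease the speed. But an orbit of [L] that comes
    from outside [V0] enters the ball [U] with a speed bounded from below, and the
    speed tends to [0] when the orbit approaches the singularity. *)
Lemma singular_gap (V0 : set M) : nbhs sigma V0 ->
  (forall W, nbhs sigma W -> exists y t, [/\ L y, ~ V0 y, 0 <= t & W (X t y)]) ->
  (\dim (E sigma) < \dim (Es sigma))%N.
Proof.
move=> nV0 rec; rewrite ltnNge; apply/negP => dim_le.
have EsE : (Es sigma <= E sigma)%VS.
  have /eqP -> : (E sigma == Es sigma)%VS by rewrite eqEdim subset_stable.
  exact: subvv.
have FEu := center_unstable EsE.
have [T T0 [expandB nofix]] := hyperbolic_time Mc sing dX hyp.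
have T0' := ltW T0.
pose B : 'End('rV[R]_n) := tmap (X T) sigma.
set i := chart_at sigma; set z0 := chart i sigma; pose Y := local_field X i.
have dsg : dom i sigma := dom_chart_at sigma.
have [CB CB0 leCB] := linear_bounded (B : {linear 'rV[R]_n -> 'rV[R]_n}).
have [m m0 lem] : exists2 m, 0 < m & forall h, m * `|h| <= `|B h - h|.
  have subE h : (B - \1)%VF h = B h - h by rewrite add_lfunE opp_lfunE id_lfunE.
  have [|m m0 lem] := @injective_lower_bound _ _ (B - \1)%VF.
    by move=> h; rewrite subE => /eqP; rewrite subr_eq0 => /eqP/nofix.
  by exists m => // h; have := lem h; rewrite subE.
have [rV rV0 sub_V0] := chart_ball_sub dsg nV0.
have [r1 r10 stay] := stay_near sing T0' rV0.
have m20 : 0 < m / 2 by rewrite divr_gt0.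
have [r2 r20 sd] := flow_strict_diff Mc sing T0' m20 (dX T).
have [C C0 [r3 r30 disp]] := displacement sing T0'.
have e40 : 0 < 4^-1 :> R by rewrite invr_gt0.
have [r4 r40 vel] := velocity_transport Mc sing T0' e40 (dX T).
(* With this error the vector [f] of [F sigma] that replaces a velocity [v] has
   [|B f| >= 2 * |f|], and all errors together remain below [|f|]. *)
pose e5 := Num.min 4^-1 (4^-1 / CB).
have e50 : 0 < e5 by rewrite lt_min e40 divr_gt0.
have [[_ sF] _ _ _] := domEF.
have [r5 r50 frame] := chart_ball_sub dsg (subbundle_near sF Lsigma e50).
pose r := Num.min r1 (Num.min r2 (Num.min r3 (Num.min r4 r5))).
have r0 : 0 < r by rewrite !lt_min r10 r20 r30 r40.
pose U := [set y | dom i y /\ `|chart i y - z0| < r].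
have nU : nbhs sigma U.
  apply: (near_chart (P := [set z | `|z - z0| < r]) dsg).
  have Fz : Filter (nbhs z0) := nbhs_filter z0.
  by apply: (cvgr_lt _ (@continuous_dist R n z0 z0)); rewrite subrr normr0.
have [U1 U2 U3 U4 U5] : [/\ forall y, U y -> `|chart i y - z0| <= r1,
    forall y, U y -> `|chart i y - z0| <= r2, forall y, U y -> `|chart i y - z0| <= r3,
    forall y, U y -> `|chart i y - z0| < r4 & forall y, U y -> `|chart i y - z0| < r5].
  by split=> y [_]; rewrite !lt_min => /and5P[] *; rewrite ?ltW.
pose v y := Y (chart i y).
have grow y : L y -> U y -> `|v y| <= `|v (X T y)|.
  move=> Ly Uy; have [_ tr] := vel y Uy.1 (U4 y Uy).
  have vF : field X y \in F y := field_in_center Mc XL domEF lam0 conE Ly.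
  have [f fF] := frame y Uy.1 (U5 y Uy) Ly _ vF.
  rewrite -[tcoord _ _ _](local_fieldE X Uy.1) -/Y -/(v y) => vf.
  have := expandB f (subvP FEu f fF).
  move: tr; rewrite -/Y -/(v y) -/(v (X T y)) -/B => tr Bf.
  have e5f : e5 * `|f| <= 4^-1 * `|f| by rewrite ler_wpM2r// ge_min lexx.
  have le1 : `|B (v y) - B f| <= 4^-1 * `|f|.
    rewrite -linearB; apply: le_trans (leCB _) _.
    have le_CB : CB * e5 <= 4^-1 by rewrite mulrC -ler_pdivlMr// ge_min lexx orbT.
    have := ler_wpM2r (normr_ge0 f) le_CB; rewrite -mulrA => /(le_trans _); apply.
    by rewrite ler_wpM2l// ltW.
  have t1 : `|v y| <= `|f| + `|v y - f|.
    by rewrite -[X in `|X| <= _](subrKC f (v y)) ler_normD.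
  have t2 : `|B f| <= `|B (v y)| + `|B (v y) - B f|.
    by rewrite -{1}[B f](subKr (B (v y))) ler_normB.
  have t3 : `|B (v y)| <= `|v (X T y)| + `|v (X T y) - B (v y)|.
    by rewrite -{1}[B (v y)](subKr (v (X T y))) ler_normB.
  by have f0 := normr_ge0 f; lra.
(* A slow point hardly moves in time [T], while [B] moves all vectors by a
   definite fraction of their length. *)
have lower y : U y -> m / (2 * C) * `|chart i y - z0| <= `|v y|.
  move=> Uy; have [_ dy] := disp y Uy.1 (U3 y Uy); rewrite -/i -/Y -/(v y) in dy.
  have zr : `|z0 - z0| <= r2 by rewrite subrr normr0 ltW.
  have [_ _] := sd y sigma Uy.1 dsg (U2 y Uy) zr.
  rewrite (flow_fixed Mc sing T) -/i -/z0 -/B; set h := chart i y - z0 => sdh.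
  have lh := lem h.
  have : `|B h - h| <= `|chart i (X T y) - chart i y| + `|chart i (X T y) - z0 - B h|.
    have -> : B h - h = (chart i (X T y) - chart i y) - (chart i (X T y) - z0 - B h).
      by rewrite /h; move: (B _) => b; apply/rowP => k; rewrite !mxE; ring.
    exact: ler_normB.
  move=> le1; rewrite -(ler_pM2l C0).
  have -> : C * (m / (2 * C) * `|h|) = m / 2 * `|h| by field; rewrite gt_eqF.
  lra.
have [rw rw0 pull] : exists2 rw, 0 < rw &
    forall y, dom i y -> `|chart i y - z0| < rw -> U (X (- T) y).
  apply: (chart_ball_sub (P := X (- T) @^-1` U) dsg).
  have cX := flow_continuous Mc (X := X) (t := - T) (x := sigma).
  by apply: cX; rewrite (flow_fixed Mc sing).
pose mu := m / (2 * C) * rw.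
have mu0 : 0 < mu by rewrite mulr_gt0// divr_gt0// mulr_gt0.
(* Going back from [w] by steps of length [T] until leaving [U], the last point
   found in [U] has distance at least [rw] from the singularity, and the speed has
   not decreased since. *)
have fast N w : L w -> U w -> ~ U (X (- (N%:R * T)) w) -> mu <= `|v w|.
  elim: N w => [|N IH] w Lw Uw; first by rewrite mul0r oppr0 flow0.
  move=> nUw; pose w' := X (- T) w.
  have Lw' : L w' := along_flow XL (- T) Lw.
  have Xw' : X T w' = w by exact: flowKN.
  have [Uw'|nUw'] := pselect (U w').
    rewrite -Xw'; apply: le_trans (grow w' Lw' Uw'); apply: IH => //.
    have -> : X (- (N%:R * T)) w' = X (- (N.+1%:R * T)) w; last exact: nUw.
    by rewrite /w' -flowD//; congr (trajectory X _ w); rewrite -natr1; ring.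
  apply: le_trans (lower w Uw); rewrite ler_wpM2l//.
    by rewrite divr_ge0// ?mulr_ge0// ltW.
  by rewrite leNgt; apply/negP => wr; apply: nUw'; exact: pull Uw.1 wr.
have nW : nbhs sigma [set y | U y /\ `|v y| < mu].
  apply: filterI => //.
  have cY : {for z0, continuous Y}.
    have [dY _] := @field_C1 _ _ _ X i.
    by apply: differentiable_continuous; apply: dY; exists sigma.
  have Fz : Filter (nbhs z0) := nbhs_filter z0.
  have Yz0 : Y z0 = 0.
    by rewrite /Y local_fieldE// tcoord_chart_at.
  have nY : nbhs z0 [set z | `|Y z| < mu].
    by apply: (cvgr_norm_lt _ cY); rewrite Yz0 normr0.
  by have := near_chart dsg nY; apply: filterS => y [].
have [y [t [Ly nVy t0 [Uw slow]]]] := rec _ nW.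
pose N := (Num.truncn (t / T)).+1.
have tN : t <= N%:R * T by rewrite -ler_pdivrMr// ltW// Num.Theory.truncnS_gt.
have NT : N%:R * T - t <= T.
  have : (Num.truncn (t / T))%:R <= t / T by rewrite Num.Theory.truncn_le divr_ge0.
  by rewrite ler_pdivlMr// /N -natr1; lra.
suff out : ~ U (X (- (N%:R * T)) (X t y)).
  by have := fast N _ (along_flow XL t Ly) Uw out; rewrite leNgt slow.
rewrite -flowD//; set s := - _ + t => Us.
(* A point of [U] at most [T] before [y] would force [y] into [V0]. *)
have sT : 0 <= - s <= T by rewrite /s; lra.
have [ds lts] := stay _ Us.1 (U1 _ Us) (- s) sT.
apply: nVy; apply: sub_V0; move: ds lts; rewrite flowNK//.
Qed.

End gap.

(** * The intersection of the two sets *)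

Section intersection.
Variables (R : realType) (n : nat) (M : manifold R n) (g : metric M).
Hypothesis Mc : compact [set: M].
Implicit Types (X : flow M) (L : set M).

Lemma omega_visits X x y (W : set M) T : omega X x y -> nbhs y W ->
  exists2 t, T <= t & W (X t x).
Proof.
move=> [t t_oo cvt] nW.
have nT : \forall k \near \oo, T <= t k by exact: (cvgryPge _).1.
have nWk : \forall k \near \oo, W (X (t k) x) by exact: cvt.
have [k [Tk Wk]] := filter_ex (filterI nT nWk).
by exists (t k).
Qed.

(** The forward orbit of a point with limit set [L] visits every neighborhood of
    [sigma] and of [p] at arbitrarily late times. So the singularity is approached
    from a distance in both directions of time, although only the forward orbit is
    known to be dense. *)
Lemma transitive_leaves X L sigma p : transitive_set X L -> L sigma -> L p ->
  p <> sigma -> invariant_set X L -> exists2 V, nbhs sigma V &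
  (forall W, nbhs sigma W -> exists y t, [/\ L y, ~ V y, 0 <= t & W (X t y)]) /\
  (forall W, nbhs sigma W -> exists y t, [/\ L y, ~ V y, 0 <= t & W (reverse X t y)]).
Proof.
move=> [x Lx omx] Ls Lp ps iL.
have [[A B] /= [sA pB] [oA oB AB0]] : exists2 AB, (sigma \in AB.1 /\ p \in AB.2) &
    [/\ open AB.1, open AB.2 & AB.1 `&` AB.2 == set0].
  have := @manifold_hausdorff _ _ M; rewrite open_hausdorff; apply.
  by apply/eqP => sp; apply: ps.
rewrite !inE in sA pB.
have nA : nbhs sigma A by exact: open_nbhs_nbhs.
have nB : nbhs p B by exact: open_nbhs_nbhs.
have notA y : B y -> ~ A y.
  by move=> By Ay; have : (A `&` B) y by []; rewrite (eqP AB0).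
have LX t : L (X t x) by rewrite -(iL t); exists x.
have os : omega X x sigma by rewrite omx.
have op : omega X x p by rewrite omx.
exists A => //; split=> W nW.
- have [t' t'0 Bt'] := omega_visits 0 op nB.
  have [t tt' Wt] := omega_visits t' os nW.
  exists (X t' x), (t - t'); split; rewrite ?subr_ge0//; first exact: notA.
  by rewrite -flowD// subrK.
- have [t t0 Wt] := omega_visits 0 os nW.
  have [t' tt' Bt'] := omega_visits t op nB.
  exists (X t' x), (t' - t); split; rewrite ?subr_ge0//; first exact: notA.
  by rewrite /= opprB -flowD// subrK.
Qed.

Lemma center_cap_dims (E F E' F' : {vspace 'rV[R]_n}) :
  (E + F)%VS = fullv /\ directv (E + F) -> (E' + F')%VS = fullv /\ directv (E' + F') ->
  (\dim (F :&: F') <= 1)%N -> (n <= \dim E + \dim E' + 1)%N.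
Proof.
move=> [full dir] [full' dir'] cap.
have := splitting_dim full dir; have := splitting_dim full' dir'.
have := dimv_sum_cap F F'; have := dimvS (subvf (F + F')%VS).
rewrite dimvf /dim/= mul1n; lia.
Qed.

(** A common vector is contracted in the past, so its past is bounded. *)
Lemma contracting_cap X L L' E E' K lam K' lam' x :
  differentiable_along X L -> invariant_bundle X L E -> 0 < lam ->
  contracting g X L E K lam -> 0 < lam' -> contracting g (reverse X) L' E' K' lam' ->
  L x -> L' x -> (E x :&: E' x)%VS = 0%VS.
Proof.
move=> XL iE lam0 cE lam'0 cE' Lx L'x; apply/eqP; rewrite -subv0; apply/subvP => v.
rewrite memv_cap memv0 => /andP[vE vE']; apply/eqP.
apply: (contracting_bounded_past Mc XL iE lam0 cE Lx vE (B := `|K'| * tnorm g x v)) => t t0.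
exact: (contracting_orbit_bounded lam'0 cE' L'x vE' t0).
Qed.

(** The past of [a] is bounded, because [b] is contracted in the past and the
    velocity is bounded along its orbit; hence [a = 0]. The same holds for [b] and
    the future. *)
Lemma hyperbolic_independent X L L' E E' K lam K' lam' x a b c :
  differentiable_along X L -> differentiable_along X L' ->
  invariant_bundle X L E -> invariant_bundle X L' E' ->
  0 < lam -> contracting g X L E K lam ->
  0 < lam' -> contracting g (reverse X) L' E' K' lam' ->
  L x -> L' x -> a \in E x -> b \in E' x ->
  a + c *: field X x + b = 0 -> a = 0 /\ b = 0.
Proof.
move=> XL XL' iE iE' lam0 cE lam'0 cE' Lx L'x aE bE' abc0.
have [B leB] := field_orbit_bounded g Mc XL.
have bound t (u v w : 'rV[R]_n) (D : R) : u + c *: v + w = 0 -> v = field X x ->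
    tnorm g (X t x) (tmap (X t) x u) <= D ->
    tnorm g (X t x) (tmap (X t) x w) <= D + `|c| * B.
  move=> uvw0 vX uD; have wE : w = - (u + c *: v).
    by apply/eqP; rewrite -addr_eq0 addrC uvw0.
  have Tw : tmap (X t) x w = - (tmap (X t) x u + c *: tmap (X t) x v).
    by rewrite wE linearN linearD linearZ.
  apply: le_trans (le_of_eq (congr1 (tnorm g _) Tw)) _.
  rewrite tnormN; apply: le_trans (tnormD _ _ _) _; rewrite lerD//.
  by rewrite tnormZ ler_wpM2l// vX; exact: leB.
split.
- apply: (contracting_bounded_past Mc XL iE lam0 cE Lx aE
    (B := `|K'| * tnorm g x b + `|c| * B)) => t t0.
  apply: (bound (- t) b (field X x)) => //; first by rewrite addrC addrA addrAC.
  exact: (contracting_orbit_bounded lam'0 cE' L'x bE' t0).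
- have iE'r : invariant_bundle (reverse X) L' E' by move=> t; exact: iE'.
  apply: (contracting_bounded_past Mc (differentiable_along_reverse XL') iE'r lam'0 cE' L'x bE'
    (B := `|K| * tnorm g x a + `|c| * B)) => t t0.
  have -> : reverse X (- t) = X t by rewrite /= opprK.
  apply: (bound t a (field X x)) => //.
  exact: (contracting_orbit_bounded lam0 cE Lx aE t0).
Qed.

Lemma subbundle_subset L L' E : L `<=` L' -> subbundle L' E -> subbundle L E.
Proof.
move=> LL' sE x Lx; have [U [d [b [oU Ux Ud cb bE]]]] := sE x (LL' x Lx).
exists U, d, b; split=> // [k|y [Ly Uy]]; last first.
  by apply: bE; split=> //; exact: LL'.
have sub : L `&` U `<=` L' `&` U by move=> y [Ly Uy]; split=> //; exact: LL'.
exact: continuous_subspaceW sub (cb k).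
Qed.

Lemma flow_direction_subbundle X L : (forall x, L x -> ~ Sing X x) ->
  subbundle L (flow_direction X).
Proof.
move=> nsing x Lx; set i := chart_at x.
exists (dom i), 1%N, (fun _ y => field X y); split.
- exact: open_dom.
- exact: dom_chart_at.
- by [].
- move=> _; apply: continuous_in_subspaceT => y; rewrite inE => -[_ dy].
  have cY : {for chart i y, continuous (local_field X i)}.
    have [dY _] := @field_C1 _ _ _ X i.
    by apply: differentiable_continuous; apply: dY; exists y.
  have cc := continuous_comp (chart_continuous dy) cY.
  have E : (local_field X i \o chart i) y = tcoord i y (field X y).
    by rewrite /= local_fieldE.
  rewrite /continuous_at -E; apply: cvg_trans cc; apply: near_eq_cvg; near=> z.
  have dz : dom i z by near: z; exact: near_dom.
  by rewrite /= local_fieldE.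
- move=> y [Ly _]; have X0 : field X y != 0 :> 'rV_n by apply/eqP; exact: nsing.
  have -> : [tuple field X y | k < 1] = [tuple field X y] :> 1.-tuple 'rV[R]_n.
    by apply: eq_from_tnth => k; rewrite tnth_mktuple (tnth_nth 0) ord1.
  by rewrite /basis_of/= span_seq1 eqxx seq1_free.
Unshelve. all: by end_near. Qed.

End intersection.

Lemma contracting_weaken (R : realType) n (M : manifold R n) (g : metric M)
    (X : flow M) (L L1 : set M) (E : subspaces M) (K K1 lam lam1 : R) :
  L1 `<=` L -> K <= K1 -> 0 <= K1 -> lam1 <= lam ->
  contracting g X L E K lam -> contracting g X L1 E K1 lam1.
Proof.
move=> LL KK K10 ll cE x v t Lx vE t0; apply: le_trans (cE x v t (LL x Lx) vE t0) _.
rewrite ler_wpM2r ?tnorm_ge0//; apply: (@le_trans _ _ (K1 * expR (- lam * t))).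
  by rewrite ler_wpM2r ?expR_ge0.
by rewrite ler_wpM2l// ler_expR ler_wpM2r// lerN2.
Qed.

Section hyperbolicity.
Variables (R : realType) (n : nat) (M : manifold R n) (g : metric M).
Hypothesis Mc : compact [set: M].
Variables (X : flow M) (Lp Lm : set M) (E F E' F' : subspaces M).
Variables (K lam K' lam' K2 lam2 K2' lam2' : R).
Hypotheses (domP : dominated_splitting g X Lp E F)
  (domN : dominated_splitting g (reverse X) Lm E' F').
Hypotheses (iLp : invariant_set X Lp) (iLm : invariant_set (reverse X) Lm).
Hypotheses (lam0 : 0 < lam) (conP : contracting g X Lp E K lam).
Hypotheses (K'0 : 0 < K') (lam'0 : 0 < lam')
  (conN : contracting g (reverse X) Lm E' K' lam').
Hypotheses (K20 : 0 < K2) (lam20 : 0 < lam2)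
  (secP : sectionally_expanding g X Lp F K2 lam2).
Hypotheses (K2'0 : 0 < K2') (lam2'0 : 0 < lam2')
  (secN : sectionally_expanding g (reverse X) Lm F' K2' lam2').

Let XLp : differentiable_along X Lp.
Proof.
have [_ [iE iF] sp _] := domP; apply: (splitting_differentiable iLp iE iF) => x Lx.
by case: (sp x Lx).
Qed.

Let XLm' : differentiable_along (reverse X) Lm.
Proof.
have [_ [iE iF] sp _] := domN; apply: (splitting_differentiable iLm iE iF) => x Lx.
by case: (sp x Lx).
Qed.

Let XLm : differentiable_along X Lm := differentiable_along_of_reverse XLm'.

Lemma strong_dims x : Lp x -> Lm x -> (n <= \dim (E x) + \dim (E' x) + 1)%N.
Proof.
move=> Lpx Lmx; have [_ _ spP _] := domP; have [_ [_ iF'] spN _] := domN.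
apply: (center_cap_dims (spP x Lpx) (spN x Lmx)).
apply: (center_cap_dim Mc XLp (invariant_bundle_reverse iF') K20 lam20 secP K2'0
  lam2'0 secN) => // t.
exact: (along_flow XLm).
Qed.

Lemma intersection_invariant : invariant_set X (Lp `&` Lm).
Proof.
move=> t; apply/seteqP; split=> [_ [x [Lpx Lmx] <-]|x [Lpx Lmx]].
  by split; apply: along_flow.
exists (X (- t) x); last exact: flowKN.
by split; apply: along_flow.
Qed.

(** By [singular_gap] for the flow and for its reverse, the stable and unstable
    spaces of the singularity have dimensions greater than [E] and [E'], so the
    sum of these dimensions would be at least [n + 1]. *)
Lemma no_common_singularity sigma p q : transitive_set X Lp -> transitive_set X Lm ->
  Lp sigma -> Lm sigma -> Sing X sigma -> Lp p -> p <> sigma -> Lm q -> q <> sigma ->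
  hyperbolic g X [set sigma] -> hyperbolic g (reverse X) [set sigma] -> False.
Proof.
move=> trP trN Lps Lms sing Lpp ps Lmq qs [_ _ [Es [Eu hP]]] [_ _ [Es' [Eu' hN]]].
have sing' : Sing (reverse X) sigma by rewrite /Sing/= sing oppr0.
have [V nV [recV _]] := transitive_leaves Mc trP Lps Lpp ps iLp.
have iLmX : invariant_set X Lm := XLm.1.
have [V' nV' [_ recV']] := transitive_leaves Mc trN Lms Lmq qs iLmX.
have gapP := singular_gap Mc XLp domP lam0 conP Lps sing hP nV recV.
have gapN := singular_gap Mc XLm' domN lam'0 conN Lms sing' hN nV' recV'.
have dims := strong_dims Lps Lms.
have dX t : differentiable_at (X t) sigma := XLp.2 t sigma Lps.
have sm := singleton_differentiable Mc sing dX.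
have [_ [iEs _ _] _ [Kh [lh [Kh0 lh0 cEs _]]]] := hP.
have [_ _ _ [Kh' [lh' [Kh'0 lh'0 cEs' _]]]] := hN.
have cap := contracting_cap Mc sm iEs lh0 cEs lh'0 cEs' (erefl sigma) (erefl sigma).
have := dimv_disjoint_sum cap; have := dimvS (subvf (Es sigma + Es' sigma)%VS).
by rewrite dimvf /dim/= mul1n; clear - dims gapP gapN; lia.
Qed.

(** The three summands are independent, and they fill the tangent space by
    [strong_dims], since the flow direction is a line. *)
Lemma regular_hyperbolic_splitting : (forall x, (Lp `&` Lm) x -> ~ Sing X x) ->
  hyperbolic_splitting g X (Lp `&` Lm) E E'.
Proof.
move=> nsing; have [[sE _] [iE _] _ _] := domP; have [[sE' _] [iE'r _] _ _] := domN.
have iE' := invariant_bundle_reverse iE'r.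
have indep x a b c : (Lp `&` Lm) x -> a \in E x -> b \in E' x ->
    a + c *: field X x + b = 0 -> a = 0 /\ b = 0.
  move=> [Lpx Lmx]; exact: (hyperbolic_independent Mc XLp XLm iE iE' lam0 conP lam'0 conN).
split.
- split; last by apply: subbundle_subset sE' => x [].
    by apply: subbundle_subset sE => x [].
  exact: flow_direction_subbundle.
- split=> t x [Lpx Lmx]; [exact: iE| |exact: iE'].
  rewrite /flow_direction limg_line; congr (<[_]>)%VS.
  exact: (tmap_field Mc (XLp.2 t x Lpx)).
- move=> x Hx; have [Lpx Lmx] := Hx.
  have X0 : field X x != 0 :> 'rV_n by apply/eqP; exact: nsing.
  have cap1 : (E x :&: flow_direction X x = 0)%VS.
    apply/eqP; rewrite -subv0; apply/subvP => v; rewrite memv_cap memv0.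
    move=> /andP[vE /vlineP[c vc]]; apply/eqP.
    have nvE : - v \in E x by rewrite rpredN.
    have sum0 : - v + c *: field X x + 0 = 0 by rewrite addr0 vc addNr.
    have [v0 _] := indep x (- v) 0 c Hx nvE (mem0v _) sum0.
    by rewrite -[v]opprK v0 oppr0.
  have cap2 : ((E x + flow_direction X x) :&: E' x = 0)%VS.
    apply/eqP; rewrite -subv0; apply/subvP => v; rewrite memv_cap memv0.
    move=> /andP[/memv_addP[a aE [w /vlineP[c ->] vE]] vE']; apply/eqP.
    have nvE' : - v \in E' x by rewrite rpredN.
    have sum0 : a + c *: field X x + - v = 0 by rewrite vE subrr.
    have [_ v0] := indep x a (- v) c Hx aE nvE' sum0.
    by rewrite -[v]opprK v0 oppr0.
  have dirE : directv (E x + flow_direction X x + E' x).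
    by rewrite directvE/= (dimv_disjoint_sum cap2) (dimv_disjoint_sum cap1).
  split=> //; apply/eqP; rewrite eqEdim subvf/=.
  rewrite (dimv_disjoint_sum cap2) (dimv_disjoint_sum cap1) dim_vline X0.
  have := strong_dims Lpx Lmx; rewrite dimvf /dim/= mul1n; lia.
pose K1 := Num.max K K'; pose lam1 := Num.min lam lam'.
have K10 : 0 < K1 by rewrite lt_max K'0 orbT.
exists K1, lam1; split=> //; first by rewrite lt_min lam0.
  apply: contracting_weaken conP => [x []//| | |]; first by rewrite le_max lexx.
    exact: ltW.
  by rewrite ge_min lexx.
have cN1 : contracting g (reverse X) Lm E' K1 lam1.
  apply: contracting_weaken conN => //; first by rewrite le_max lexx orbT.
    exact: ltW.
  by rewrite ge_min lexx orbT.
have exN := contracting_expanding Mc XLm K10 iE' cN1.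
by move=> x v t [_ Lmx]; exact: exN.
Qed.

End hyperbolicity.

Theorem theorem2p2 (R : realType) (n : nat) (M : manifold R n) (g : metric M)
    (X : flow M) (Lp Lm : set M) :
  compact [set: M] ->
  transitive_set X Lp -> positively_sectional_hyperbolic g X Lp ->
  transitive_set X Lm -> negatively_sectional_hyperbolic g X Lm ->
  hyperbolic g X (Lp `&` Lm).
Proof.
move=> Mc trP [cLp iLp singP [E [F [[dP [K [lam [K0 lam0 cP]]]]
  [K2 [lam2 [K20 lam20 sP]]]]]]]
  trN [cLm iLm singN [E' [F' [[dN [K' [lam' [K'0 lam'0 cN]]]]
  [K2' [lam2' [K2'0 lam2'0 sN]]]]]]].
have iH : invariant_set X (Lp `&` Lm) :=
  intersection_invariant Mc dP dN iLp iLm.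
have cH : compact (Lp `&` Lm).
  apply: compact_closedI => //; apply: compact_closed => //.
  exact: manifold_hausdorff.
split=> //.
have [[sigma [[Lps Lms] sing]]|nsing] :=
    pselect (exists s, (Lp `&` Lm) s /\ Sing X s); last first.
  exists E, E'.
  apply: (regular_hyperbolic_splitting Mc dP dN iLp iLm lam0 cP K'0 lam'0 cN
    K20 lam20 sP K2'0 lam2'0 sN) => x Hx sx.
  by apply: nsing; exists x.
have hP := singP sigma (conj Lps sing).
have single : Lp `&` Lm `<=` [set sigma] -> exists Es Eu,
    hyperbolic_splitting g X (Lp `&` Lm) Es Eu.
  move=> sub; have -> : Lp `&` Lm = [set sigma].
    by apply/seteqP; split=> // _ ->.
  by case: hP.
have [[p [Lpp ps]]|nP] := pselect (exists p, Lp p /\ p <> sigma); last first.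
  apply: single => y [Lpy _] /=; apply: contrapT => ys.
  by apply: nP; exists y.
have [[q [Lmq qs]]|nN] := pselect (exists q, Lm q /\ q <> sigma); last first.
  apply: single => y [_ Lmy] /=; apply: contrapT => ys.
  by apply: nN; exists y.
have hN : hyperbolic g (reverse X) [set sigma].
  by apply: singN; split=> //; rewrite /Sing/= sing oppr0.
case: (no_common_singularity Mc dP dN iLp iLm lam0 cP lam'0 cN K20 lam20 sP
  K2'0 lam2'0 sN trP trN Lps Lms sing Lpp ps Lmq qs hP hN).
Qed.
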